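(* In the setting and with the notation of the context: for every $T>0$ and $\delta>0$ there exists $\varepsilon>0$ such that, for every $v_0\in\mathcal X$ with $\|v_0\|_{\mathcal X}\le\varepsilon$ and every continuous solution $u:[0,T]\to\mathcal X$ of $$u(t)=S(t,0)u_0+\int_0^tS(t,t')\big(F(u(t'))-F'(\hat u(t'))u(t')\big)\,\mathrm dt',\qquad t\in[0,T],$$ with initial condition $u_0=u^*+v_0$, we have $$\|u(t)-\Pi(\gamma_t)u^*\|_{\mathcal X}\le(M_3e^{-at}+\delta)\|v_0\|_{\mathcal X},\qquad t\in[0,T],$$ where $\gamma_t=\exp(tX)\exp(e^{tL}\mathcal Pv_0)\in\mathbb G$.
   Context: **Setting.** $\mathcal X$ is a real Banach space, $\mathcal L(\mathcal X)$ the bounded linear operators on it. $A$ is a closed (possibly unbounded) linear operator on $\mathcal X$ with domain $\mathcal D(A)$, and $F:\mathcal X\to\mathcal X$ is a map. The equation is $\mathrm du=Au\,\mathrm dt+F(u)\,\mathrm dt$. Standing assumptions: (1) Symmetry. $\mathbb G$ is a matrix Lie group with Lie algebra $\mathfrak g$ (bracket $[\cdot,\cdot]$, exponential map $\exp(Y)=e^Y$, a fixed norm $\|\cdot\|_{\mathfrak g}$), and $\Pi:\mathbb G\to\mathcal L(\mathcal X)$ is a group homomorphism such that: for $g\in\mathbb G$ and $\phi\in\mathcal D(A)$ we have $\Pi(g)\phi\in\mathcal D(A)$ and $A\phi=\Pi(g)A\Pi(g^{-1})\phi$; for $g\in\mathbb G$ and $\phi\in\mathcal X$, $F(\phi)=\Pi(g)F(\Pi(g^{-1})\phi)$;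 for each $\phi\in\mathcal X$ the map $g\mapsto\Pi(g)\phi$ is continuous; $\sup_{g}\|\Pi(g)\|_{\mathcal L(\mathcal X)}<\infty$. For $Y\in\mathfrak g$, $\pi(Y)$ is the unbounded operator $\pi(Y)\phi=\lim_{t\to0}t^{-1}(\Pi(e^{tY})\phi-\phi)$ (limit in $\mathcal X$), whose domain $\mathcal D(\pi(Y))$ consists of all $\phi\in\mathcal X$ for which the limit exists. (2) Symmetry solution. There are $X\in\mathfrak g$ and $u^*\in\mathcal D(A)\cap\mathcal D(\pi(X))$ such that $\hat u(t)=\Pi(e^{tX})u^*$, $t\ge0$, is a strong solution of the equation. Moreover $u^*\in\mathcal D(\pi(Y))$ for all $Y\in\mathfrak g$ and there is a constant $C$ with $\|\Pi(e^Y)u^*-u^*-\pi(Y)u^*\|_{\mathcal X}\le C\|Y\|_{\mathfrak g}^2$ for all $Y\in\mathfrak g$. (3) Linearization. $F$ is Fréchet differentiable at $u^*$, and $\mathcal L^*:\phi\mapsto A\phi-\pi(X)\phi+F'(u^* )\phi$ (natural domain $\mathcal D(A)\cap\mathcal D(\pi(X))$; $^*$ does not denote an adjoint) generates a bounded $C_0$-semigroup $(S^*(t))_{t\ge0}$ on $\mathcal X$. (4) Decomposition. The center space is $\mathcal V=\{\pi(Y)u^*:Y\in\mathfrak g\}$. There are projections $P_c^*,P_s^*\in\mathcal L(\mathcal X)$ with $I=P_c^*+P_s^*$, range of $P_c^*$ equal to $\mathcal V$, and constants $M,a>0$ with $\|S^*(t)P_s^*\|_{\mathcal L(\mathcal X)}\le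 Me^{-at}$ for $t\ge0$. (5) Regularity of $F$. For every $R>0$ there is $C$ with $\|F(v)-F(u^* )-F'(u^* )[v-u^*]\|_{\mathcal X}\le C\|v-u^*\|_{\mathcal X}^2$ for all $v\in\mathcal X$ with $\|v-u^*\|_{\mathcal X}\le R$. Notation: $L:\mathfrak g\to\mathfrak g$, $LY=[Y,X]$; $\mathcal P:\mathcal X\to\mathfrak g$ is a fixed bounded linear map with $P_c^*\phi=\pi(\mathcal P\phi)u^*$ for $\phi\in\mathcal X$. For $0\le t'\le t$: $S(t,t')=\Pi(e^{tX})S^*(t-t')\Pi(e^{-t'X})$ and $P_s(t)=\Pi(e^{tX})P_s^*\Pi(e^{-tX})$. The constants $M_3,a>0$ are such that $\|S(t,t')P_s(t')\|_{\mathcal L(\mathcal X)}\le M_3e^{-a(t-t')}$ for all $0\le t'\le t$. In the notion of solution it is understood that the integral is a well-defined Bochner integral. *)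

(* Defs.v *)
From HB Require Import structures.
From mathcomp Require Import all_boot all_order all_algebra.
From mathcomp Require Import complex.
From mathcomp Require Import all_classical all_reals all_analysis.

Set Implicit Arguments.
Unset Strict Implicit.
Unset Printing Implicit Defensive.

Import Order.TTheory GRing.Theory Num.Theory.
Import numFieldNormedType.Exports.

Local Open Scope classical_set_scope.
Local Open Scope complex_scope.
Local Open Scope ring_scope.

(* The topology of the complex numbers given by the modulus. *)
HB.instance Definition _ (R : rcfType) := PseudoPointedMetric.copy R[i] R[i]^o.

Section OperatorNorm.
Context (R : realType) (X : normedModType R).

Definition opnorm (T : X -> X) : \bar R :=
  ereal_sup [set (`|T phi|)%:E | phi in [set phi : X | `|phi| <= 1]].

End OperatorNorm.

(* A simple function is given by a finite family of pairs (B_i, x_i) and stands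
   for \sum_i 1_(B_i) x_i; the B_i need not be disjoint. *)
Section Bochner.
Context d (T : measurableType d) (R : realType) (X : normedModType R).
Context (mu : {measure set T -> \bar R}).

Definition simple_val (s : seq (set T * X)) (t : T) : X :=
  \sum_(p <- s) \1_(p.1) t *: p.2.

Definition simple_int (s : seq (set T * X)) : X :=
  \sum_(p <- s) fine (mu p.1) *: p.2.

Fixpoint simple_on (D : set T) (s : seq (set T * X)) : Prop :=
  if s is p :: s' then
    [/\ measurable p.1, p.1 `<=` D, (mu p.1 < +oo)%E & simple_on D s']
  else True.

(* f is Bochner integrable over D with integral I. The almost everywhere
   convergence says that f is strongly measurable, up to a null set. The
   integrands |f - s_k| then agree almost everywhere with measurable functions,
   so their integrals are meaningful even if the sigma-algebra is not complete. *)
Definition is_bochner_integral (D : set T) (f : T -> X) (I : X) : Prop :=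
  exists s : nat -> seq (set T * X),
  [/\ forall k, simple_on D (s k),
      {ae mu, forall t, D t -> simple_val (s k) t @[k --> \oo] --> f t},
      (\int[mu]_(t in D) (`|f t - simple_val (s k) t|)%:E)%E @[k --> \oo]
        --> 0%E &
      simple_int (s k) @[k --> \oo] --> I].

End Bochner.

Section UnboundedOperators.
Context (R : realType) (X : normedModType R).

(* An unbounded operator is given by its domain D and by a total function L of
   which only the values on D matter. *)
Definition closed_operator (D : set X) (L : X -> X) : Prop :=
  [/\ D 0,
      forall (a : R) phi psi, D phi -> D psi ->
        D (a *: phi + psi) /\ L (a *: phi + psi) = a *: L phi + L psi &
      closed [set p : X * X | D p.1 /\ p.2 = L p.1]].

Record bounded_C0_semigroup (S : R -> {linear X -> X}) : Prop := {
  semigroup_continuous : forall t, 0 <= t -> continuous (S t) ;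
  semigroup0 : forall phi, S 0 phi = phi ;
  semigroupD : forall s t phi, 0 <= s -> 0 <= t -> S (s + t) phi = S s (S t phi) ;
  semigroup_C0 : forall phi, S t phi @[t --> 0^'+] --> phi ;
  semigroup_bounded : exists K : R, forall t, 0 <= t -> (opnorm (S t) <= K%:E)%E
}.

Definition generates (D : set X) (L : X -> X) (S : R -> {linear X -> X}) : Prop :=
  D = [set phi | cvg (t^-1 *: (S t phi - phi) @[t --> 0^'+])] /\
  forall phi, D phi -> t^-1 *: (S t phi - phi) @[t --> 0^'+] --> L phi.

Definition strong_solution (DA : set X) (A F : X -> X) (u : R -> X) : Prop :=
  [/\ {within `[0, +oo[, continuous u},
      forall t, 0 <= t -> DA (u t) &
      forall t, 0 <= t ->
        is_bochner_integral (@lebesgue_measure R) `[0, t]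
          (fun s => A (u s) + F (u s)) (u t - u 0)].

Definition is_projection (P : X -> X) : Prop :=
  continuous P /\ forall phi, P (P phi) = P phi.

End UnboundedOperators.

(* Matrices are complex, so that real matrix groups are a special case. The Lie
   algebra is a real vector space, which need not be a complex one. *)
Section MatrixLieGroups.
Context (R : realType) (n : nat).
Local Notation M := 'M[R[i]]_n.

Definition rscale (t : R) (Y : M) : M := t%:C *: Y.

(* exp(L) Y for a linear map L on matrices *)
Definition exp_op (L : M -> M) (Y : M) : M :=
  limn (series (fun k => rscale (k`!%:R)^-1 (iter k L Y))).

Definition expm (Y : M) : M :=
  limn (series (fun k => rscale (k`!%:R)^-1 (Y ^+ k))).

Record matrix_Lie_group (G : set M) : Prop := {
  mxgroup_unit : forall g, G g -> g \in unitmx ;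
  mxgroup1 : G 1%:M ;
  mxgroupM : forall g h, G g -> G h -> G (g *m h) ;
  mxgroupV : forall g, G g -> G (invmx g) ;
  mxgroup_closed : forall g, closure G g -> g \in unitmx -> G g
}.

Definition Lie_algebra (G : set M) : set M :=
  [set Y | forall t : R, G (expm (rscale t Y))].

Definition bracket (Y Z : M) : M := Y *m Z - Z *m Y.

Record is_norm_on (g : set M) (N : M -> R) : Prop := {
  norm_on_ge0 : forall Y, g Y -> 0 <= N Y ;
  norm_on_eq0 : forall Y, g Y -> N Y = 0 -> Y = 0 ;
  norm_onZ : forall (t : R) Y, g Y -> N (rscale t Y) = `|t| * N Y ;
  norm_onD : forall Y Z, g Y -> g Z -> N (Y + Z) <= N Y + N Z
}.

Context (X : normedModType R).
Implicit Types (Pi : M -> {linear X -> X}).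

(* Only the values of Pi on G matter. *)
Record symmetry_group (G : set M) Pi (DA : set X) (A F : X -> X) : Prop := {
  symm_continuous : forall g, G g -> continuous (Pi g) ;
  symm1 : forall phi, Pi 1%:M phi = phi ;
  symmM : forall g h phi, G g -> G h -> Pi (g *m h) phi = Pi g (Pi h phi) ;
  symm_dom : forall g phi, G g -> DA phi -> DA (Pi g phi) ;
  symm_A : forall g phi, G g -> DA phi -> A phi = Pi g (A (Pi (invmx g) phi)) ;
  symm_F : forall g phi, G g -> F phi = Pi g (F (Pi (invmx g) phi)) ;
  symm_strong : forall phi, {within G, continuous (fun g => Pi g phi)} ;
  symm_bounded : exists K : R, forall g, G g -> (opnorm (Pi g) <= K%:E)%E
}.

Definition dPi_quot Pi (Y : M) (phi : X) (t : R) : X :=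
  t^-1 *: (Pi (expm (rscale t Y)) phi - phi).

Definition dPi_dom Pi (Y : M) : set X :=
  [set phi | cvg (dPi_quot Pi Y phi t @[t --> 0^'])].

Definition dPi Pi (Y : M) (phi : X) : X :=
  lim (dPi_quot Pi Y phi t @[t --> 0^']).

Definition symmetry_orbit Pi (Y : M) (ustar : X) (t : R) : X :=
  Pi (expm (rscale t Y)) ustar.

Definition center_space (G : set M) Pi (ustar : X) : set X :=
  [set dPi Pi Y ustar | Y in Lie_algebra G].

(* S(t, t') and P_s(t) *)
Definition evolution Pi (Y : M) (S : R -> {linear X -> X}) (t t' : R) (phi : X) : X :=
  Pi (expm (rscale t Y)) (S (t - t') (Pi (expm (rscale (- t') Y)) phi)).

Definition moving_proj Pi (Y : M) (P : {linear X -> X}) (t : R) (phi : X) : X :=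
  Pi (expm (rscale t Y)) (P (Pi (expm (rscale (- t) Y)) phi)).

End MatrixLieGroups.

Definition mild_solution (R : realType) (n : nat) (X : normedModType R)
    (Pi : 'M[R[i]]_n -> {linear X -> X}) (Y : 'M[R[i]]_n)
    (S : R -> {linear X -> X}) (F : X -> X) (ustar u0 : X) (T : R)
    (u : R -> X) : Prop :=
  forall t, 0 <= t <= T ->
    is_bochner_integral (@lebesgue_measure R) `[0, t]
      (fun t' => evolution Pi Y S t t'
         (F (u t') - 'd F (symmetry_orbit Pi Y ustar t') (u t')))
      (u t - evolution Pi Y S t 0 u0).

(* Main.v *)
Require Import Defs.
From HB Require Import structures.
From mathcomp Require Import all_boot all_order all_algebra.
From mathcomp Require Import complex.
From mathcomp Require Import all_classical all_reals all_analysis.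
From mathcomp Require Import measurable_realfun.
From mathcomp Require Import ring lra zify.

Import Order.TTheory GRing.Theory Num.Theory.
Import numFieldNormedType.Exports.

Local Open Scope classical_set_scope.
Local Open Scope ring_scope.

Set Implicit Arguments.
Unset Strict Implicit.
Unset Printing Implicit Defensive.

(** Fix v0 and put Y = calP v0, w0 = Pi (exp Y) ustar - ustar. Since
    exp(t X0) exp(e^(tL) Y) = exp Y exp(t X0) (expm_conj_flow), the state
    Pi gamma ustar of the theorem is w t = Pi (exp Y) (uhat t), the image under a
    symmetry of the solution uhat t = Pi (exp(t X0)) ustar, and therefore again a
    solution. So two solutions near uhat are compared: u, with initial deviation
    v0, and w, with initial deviation w0. Along both, the deviation from uhat is the
    linearized evolution S(t, 0) of the initial deviation, up to an error quadratic
    in the latter. Subtracting,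

      u t - w t = S(t, 0) (v0 - w0) + O(|v0|^2),

    and v0 - w0 = Ps v0 + (Pc v0 - w0), where Pc v0 = dPi Y ustar is the first order
    part of w0, so that Pc v0 - w0 is quadratic in v0. The term S(t, 0) (Ps v0) is
    bounded by M3 exp(- a t) |v0|, and on [0, T] the quadratic terms are below
    delta |v0| once |v0| is small.

    The quadratic estimates have different proofs for u and for w. The path w is
    differentiable, and in the frame moving with exp(t X0) it satisfies the linear
    equation of the semigroup up to the Taylor remainder of F at ustar; a mean value
    inequality (near_orbit_of_defect, group_orbit_defect) gives the estimate. The
    solution u is only mild, and its integral equation is compared with that of uhat,
    with the integral over uhat replaced by explicit step functions
    (orbit_integral_approx, mild_solution_defect) by the inequality
    bochner_integral_near_simple. Both estimates presuppose that the deviation is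
    small on all of [0, T], which quadratic_bootstrap derives from the estimates
    themselves. *)

(** * Continuation on an interval *)

(** Otherwise the infimum of the counterexamples would contradict the step taken
    at it. Both the mean value inequality along a semigroup and the a priori
    bound on the nonlinear paths are continuation arguments of this form. *)
Lemma real_induction (R : realType) (T : R) (P : R -> Prop) :
  (forall c, 0 <= c <= T -> (forall s, 0 <= s < c -> P s) ->
     exists2 d, 0 < d & forall s, c <= s <= T -> s < c + d -> P s) ->
  forall t, 0 <= t <= T -> P t.
Proof.
move=> step t0 t0T; apply: contrapT => nPt0.
pose E := [set s | 0 <= s <= T /\ ~ P s].
have infE : has_inf E.
  by split; [exists t0|exists 0 => s [/andP[]]].
have lbE s : E s -> inf E <= s by move=> Es; apply: ge_inf => //; case: infE.
have c0 : 0 <= inf E.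
  by apply: lb_le_inf; [exists t0|move=> s [/andP[]]].
have cT : 0 <= inf E <= T.
  rewrite c0 /=; case/andP: (t0T) => _ t0T'; exact: le_trans (lbE _ (conj t0T nPt0)) t0T'.
have [|d d0 Pd] := step (inf E) cT.
  move=> s /andP[s0 sc]; apply: contrapT => nPs.
  have : E s by split=> //; rewrite s0 /= (le_trans (ltW sc))//; case/andP: cT.
  by move/lbE; rewrite leNgt sc.
have [s [s0T nPs] sd] := inf_adherent d0 infE.
by apply/nPs/Pd => //; rewrite (lbE s (conj s0T nPs)); case/andP: s0T.
Qed.

(** * Bochner integrals near simple functions *)

Section BochnerEstimate.
Context d (T : measurableType d) (R : realType) (X : normedModType R).
Context (mu : {measure set T -> \bar R}).

(** The integral of a nonnegative function is a supremum over the simple functions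
    below it, hence monotone among arbitrary functions. This generality is what a
    Bochner integral calls for: the distance from the integrand to a simple
    function is measurable only up to a null set. *)
Lemma ge0_le_lower_integral (D : set T) (f1 f2 : T -> \bar R) :
  (forall x, D x -> 0 <= f1 x)%E -> (forall x, D x -> f1 x <= f2 x)%E ->
  (\int[mu]_(x in D) f1 x <= \int[mu]_(x in D) f2 x)%E.
Proof.
move=> f10 f12.
rewrite !ge0_integralE//; last by move=> x Dx; exact: le_trans (f10 x Dx) (f12 x Dx).
apply: ge_ereal_sup => _ [h hf1 <-]; apply: ereal_sup_ubound; exists h => //= x.
by apply: (le_trans (hf1 x)); apply: lee_restrict.
Qed.

Lemma simple_val_cons (p : set T * X) s t :
  simple_val (p :: s) t = \1_(p.1) t *: p.2 + simple_val s t.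
Proof. by rewrite /simple_val big_cons. Qed.

Lemma measurable_norm_simple (D0 : set T) (s : seq (set T * X)) (x : X) :
  simple_on mu D0 s -> measurable_fun setT (fun t => `|x + simple_val s t|).
Proof.
elim: s x => [|p s IH] x /=.
  move=> _; rewrite (_ : (fun t => _) = cst `|x|); first exact: measurable_cst.
  by apply/funext => t; rewrite /simple_val big_nil addr0.
move=> [mp _ _ /IH{}IH].
rewrite (_ : (fun t => _) = (fun t => \1_(p.1) t * `|(x + p.2) + simple_val s t| +
   (1 - \1_(p.1) t) * `|x + simple_val s t|)).
  have m1 : measurable_fun setT (\1_(p.1) : T -> R) by exact: measurable_indic.
  apply: measurable_funD; apply: measurable_funM => //.
  exact: measurable_funB.
apply/funext => t; rewrite simple_val_cons indicE.
case: (t \in p.1); rewrite /= ?scale1r ?scale0r.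
  by rewrite subrr mul0r addr0 mul1r addrA.
by rewrite subr0 mul0r !add0r mul1r.
Qed.

(** The sets of a simple function may overlap, so the triangle inequality is proved
    by splitting the domain along the first set. On the part inside it, the base
    vector x is replaced by x + p.2, which is why x and D have to vary in the
    induction. *)
Lemma le_norm_simple_int_restr (D0 D : set T) (s : seq (set T * X)) (x : X) :
  measurable D -> (mu D < +oo)%E -> simple_on mu D0 s ->
  ((`|fine (mu D) *: x + \sum_(p <- s) fine (mu (D `&` p.1)) *: p.2|)%:E <=
   \int[mu]_(t in D) (`|x + simple_val s t|)%:E)%E.
Proof.
elim: s x D => [|p s IH] x D mD Dfin /=.
  move=> _; rewrite big_nil addr0.
  under eq_integral do rewrite /simple_val big_nil addr0.
  rewrite integral_cst// normrZ ger0_norm ?fine_ge0// EFinM fineK ?ge0_fin_numE//.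
  by rewrite muleC.
move=> [mp pD0 fp sD0].
have mDp : measurable (D `&` p.1) by exact: measurableI.
have mDp' : measurable (D `\` p.1) by exact: measurableD.
have fDp : (mu (D `&` p.1) < +oo)%E.
  by apply: le_lt_trans Dfin; apply: le_measure; rewrite ?inE//; exact: subIsetl.
have fDp' : (mu (D `\` p.1) < +oo)%E.
  by apply: le_lt_trans Dfin; apply: le_measure; rewrite ?inE//; exact: subDsetl.
have split_mu (B : set T) : measurable B ->
    fine (mu (D `&` B)) = fine (mu (D `&` p.1 `&` B)) + fine (mu ((D `\` p.1) `&` B)).
  move=> mB.
  have fB E : measurable E -> E `<=` D -> mu E \is a fin_num.
    move=> mE ED; rewrite ge0_fin_numE//; apply: le_lt_trans Dfin.
    by apply: le_measure; rewrite ?inE.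
  rewrite -fineD; last 2 first.
  - by apply: fB; [exact: measurableI|move=> t [[]]].
  - by apply: fB; [exact: measurableI|move=> t [[]]].
  rewrite -measureU; [|exact: measurableI|exact: measurableI|].
    by rewrite -setIUl setUIDK.
  by rewrite -subset0 => t [[[_ h1] _] [[_ h2] _]].
have muD : fine (mu D) = fine (mu (D `&` p.1)) + fine (mu (D `\` p.1)).
  by have := split_mu setT measurableT; rewrite !setIT.
rewrite -[in leRHS](setUIDK D p.1) ge0_integral_setU//; last 2 first.
- apply/measurable_EFinP; apply: measurable_funTS.
  by apply: (measurable_norm_simple (D0 := D0)) => /=.
- by apply/disj_setPS => t [[_ h1] [_ h2]].
rewrite (eq_integral (fun t => (`|(x + p.2) + simple_val s t|)%:E)); last first.
  move=> t /set_mem[_ pt]; rewrite simple_val_cons indicE mem_set// scale1r.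
  by rewrite addrA.
rewrite [X in (_ <= _ + X)%E](eq_integral (fun t => (`|x + simple_val s t|)%:E)); last first.
  by move=> t /set_mem[_ pt]; rewrite simple_val_cons indicE memNset// scale0r add0r.
apply: le_trans (leeD (IH _ _ mDp fDp sD0) (IH _ _ mDp' fDp' sD0)).
rewrite -EFinD lee_fin; apply: le_trans (ler_normD _ _).
rewrite le_eqVlt; apply/orP; left; apply/eqP; congr (`| _ |).
rewrite big_cons.
have -> : \sum_(q <- s) fine (mu (D `&` q.1)) *: q.2 =
    \sum_(q <- s) fine (mu (D `&` p.1 `&` q.1)) *: q.2 +
    \sum_(q <- s) fine (mu ((D `\` p.1) `&` q.1)) *: q.2.
  elim: s sD0 {IH} => [|q s IHs] /=; first by rewrite !big_nil addr0.
  by move=> [mq _ _ /IHs{}IHs]; rewrite !big_cons IHs (split_mu _ mq) scalerDl addrACA.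
rewrite muD scalerDl scalerDr.
move: (\sum_(i <- s) _) (\sum_(i <- s) _) => y z.
by rewrite addrACA -[RHS]addrA [z + (_ + y)]addrCA.
Qed.

Lemma norm_simple_int_le (D : set T) (s : seq (set T * X)) :
  measurable D -> (mu D < +oo)%E -> simple_on mu D s ->
  ((`|simple_int mu s|)%:E <= \int[mu]_(t in D) (`|simple_val s t|)%:E)%E.
Proof.
move=> mD Dfin sD; have := le_norm_simple_int_restr 0 mD Dfin sD.
rewrite scaler0 add0r; under eq_integral do rewrite add0r.
congr (_ <= _)%E; congr (`|_|%:E); rewrite /simple_int.
elim: s sD => [|p s IH] /=; first by rewrite !big_nil.
by move=> [_ pD _ /IH{}IH]; rewrite !big_cons IH setIidr.
Qed.

Definition simple_sub (s r : seq (set T * X)) :=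
  s ++ [seq (p.1, - p.2) | p <- r].

Lemma simple_val_sub s r t :
  simple_val (simple_sub s r) t = simple_val s t - simple_val r t.
Proof.
rewrite /simple_val big_cat big_map/= -sumrN; congr (_ + _).
by apply: eq_bigr => p _; rewrite scalerN.
Qed.

Lemma simple_int_sub s r :
  simple_int mu (simple_sub s r) = simple_int mu s - simple_int mu r.
Proof.
rewrite /simple_int big_cat big_map/= -sumrN; congr (_ + _).
by apply: eq_bigr => p _; rewrite scalerN.
Qed.

Lemma simple_on_sub D s r :
  simple_on mu D s -> simple_on mu D r -> simple_on mu D (simple_sub s r).
Proof.
move=> + rD; elim: s => [_|p s IH]; last by move=> /= [? ? ? /IH].
by elim: r rD => [//|p r IH] /= [? ? ? /IH].
Qed.

(** If s_k approximates f, then the positive part of |s_k - s| - c is measurable and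
    below |f - s_k|, so its integral tends to 0. What remains of the integral of
    |s_k - s| is at most c times the measure of the domain. *)
Lemma bochner_integral_near_simple (D : set T) (f : T -> X) (I : X)
    (s : seq (set T * X)) (c : R) :
  measurable D -> (mu D < +oo)%E -> is_bochner_integral mu D f I ->
  simple_on mu D s -> 0 <= c -> (forall t, D t -> `|f t - simple_val s t| <= c) ->
  `|I - simple_int mu s| <= c * fine (mu D).
Proof.
move=> mD Dfin [s_ [s_on _ f_s_ I_s_]] sD c0 fsc.
have est k : ((`|simple_int mu (s_ k) - simple_int mu s|)%:E <=
    \int[mu]_(t in D) (`|f t - simple_val (s_ k) t|)%:E + (c * fine (mu D))%:E)%E.
  rewrite -simple_int_sub.
  pose h t := `|0 + simple_val (simple_sub (s_ k) s) t|.
  have on_sub : simple_on mu D (simple_sub (s_ k) s) by exact: simple_on_sub.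
  have mh : measurable_fun setT h by exact: measurable_norm_simple on_sub.
  have mhc : measurable_fun setT (fun t => Num.max (h t - c) 0).
    by apply: measurable_maxr => //; apply: measurable_funB.
  apply: (le_trans (norm_simple_int_le mD Dfin on_sub)).
  have hle t : (h t <= Num.max (h t - c) 0 + c).
    by rewrite -lerBlDr le_max lexx.
  apply: (@le_trans _ _ (\int[mu]_(t in D) (Num.max (h t - c) 0 + c)%:E)%E).
    by apply: ge0_le_lower_integral => t Dt //; rewrite lee_fin; have := hle t; rewrite /h add0r.
  under eq_integral do rewrite EFinD.
  rewrite ge0_integralD//=; last 2 first.
  - by move=> t _; rewrite lee_fin le_max lexx orbT.
  - by apply/measurable_EFinP; apply: measurable_funTS.
  rewrite integral_cst//= EFinM fineK ?ge0_fin_numE//.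
  apply: leeD => //; apply: ge0_le_lower_integral => t Dt.
    by rewrite lee_fin le_max lexx orbT.
  rewrite lee_fin ge_max normr_ge0 andbT lerBlDr /h add0r simple_val_sub.
  have -> : simple_val (s_ k) t - simple_val s t =
     - (f t - simple_val (s_ k) t) + (f t - simple_val s t).
    by rewrite opprB addrA subrK.
  by apply: (le_trans (ler_normD _ _)); rewrite normrN lerD2l; apply: fsc.
have cv : (`|simple_int mu (s_ k) - simple_int mu s|)%:E @[k --> \oo] -->
    (`|I - simple_int mu s|)%:E.
  by apply: cvg_EFin; [exact: nearW|apply: cvg_norm; apply: cvgB => //; exact: cvg_cst].
have cv2 : (\int[mu]_(t in D) (`|f t - simple_val (s_ k) t|)%:E + (c * fine (mu D))%:E)%E
   @[k --> \oo] --> (0 + (c * fine (mu D))%:E)%E.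
  by apply: cvgeD => //; exact: cvg_cst.
rewrite -lee_fin -[leRHS]add0e.
by apply: (lee_cvg_to cv cv2); exact: nearW.
Qed.

End BochnerEstimate.

Lemma bochner_itv_near_simple (R : realType) (X : normedModType R) (t c : R)
    (f : R -> X) (I : X) (s : seq (set (measurableTypeR R) * X)) : 0 <= t ->
  is_bochner_integral (@lebesgue_measure R) `[0, t]%classic f I ->
  simple_on (@lebesgue_measure R) `[0, t]%classic s -> 0 <= c ->
  (forall x, 0 <= x <= t -> `|f x - simple_val s x| <= c) ->
  `|I - simple_int (@lebesgue_measure R) s| <= c * t.
Proof.
move=> t0 fI s_on c0 fsc.
have mu0t : lebesgue_measure (`[0, t]%classic : set (measurableTypeR R)) = t%:E.
  rewrite lebesgue_measure_itv/= lte_fin; case: ltP => [t_gt0|t_le0].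
    by rewrite oppr0 adde0.
  by congr (_%:E); apply: le_anti; rewrite t0.
rewrite -[X in _ <= _ * X]/(fine t%:E) -mu0t.
apply: bochner_integral_near_simple fI s_on c0 _; first exact: measurable_itv.
  by have := ltry t; rewrite -mu0t.
by move=> x; rewrite /= in_itv; exact: fsc.
Qed.

(** * Bounded strongly continuous semigroups *)

Section DifferenceQuotients.
Context (R : realType) (X : normedModType R).

Lemma cvg_dnbhsP (q : R -> X) (l : X) : q h @[h --> 0^'] --> l <->
  forall e, 0 < e -> exists2 d : R, 0 < d &
    forall h, h != 0 -> `|h| < d -> `|l - q h| <= e.
Proof.
split.
  move=> /cvgrPdist_le ql e e0.
  have [d /= d0 Hd] := (nbhs_ballP _ _).1 (ql e e0).
  exists d => // h h0 hd; apply: Hd => //.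
  by rewrite /ball/= sub0r normrN.
move=> H; apply/cvgrPdist_le => e e0; have [d d0 Hd] := H e e0.
apply/nbhs_ballP; exists d => //= h; rewrite /ball/= sub0r normrN => hd h0.
exact: Hd.
Qed.

Lemma cvg_rightP (q : R -> X) (l : X) : q h @[h --> 0^'+] --> l <->
  forall e, 0 < e -> exists2 d : R, 0 < d &
    forall h, 0 < h < d -> `|l - q h| <= e.
Proof.
split.
  move=> /cvgrPdist_le ql e e0.
  have [d /= d0 Hd] := (nbhs_ballP _ _).1 (ql e e0).
  exists d => // h /andP[h0 hd]; apply: Hd => //.
  by rewrite /ball/= sub0r normrN gtr0_norm.
move=> H; apply/cvgrPdist_le => e e0; have [d d0 Hd] := H e e0.
apply/nbhs_ballP; exists d => //= h; rewrite /ball/= sub0r normrN => hd h0.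
by apply: Hd; rewrite h0/= (le_lt_trans (ler_norm _) hd).
Qed.

Lemma norm_quot (h : R) (v l : X) (e : R) : h != 0 ->
  `|l - h^-1 *: v| <= e -> `|v - h *: l| <= e * `|h|.
Proof.
move=> h0 le; have -> : v - h *: l = - h *: (l - h^-1 *: v).
  by rewrite scaleNr scalerBr scalerA divff// scale1r opprB.
by rewrite normrZ normrN mulrC ler_wpM2r.
Qed.

End DifferenceQuotients.

Section Semigroup.
Context (R : realType) (X : normedModType R).

Lemma le_opnorm (f : X -> X) (K : R) (phi : X) :
  (forall a psi, f (a *: psi) = a *: f psi) ->
  (opnorm f <= K%:E)%E -> `|f phi| <= K * `|phi|.
Proof.
move=> fZ fK; have [->|phi0] := eqVneq phi 0.
  by have := fZ 0 0; rewrite !scale0r => ->; rewrite normr0 mulr0.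
have nphi : 0 < `|phi| by rewrite normr_gt0.
have : ((`|f (`|phi|^-1 *: phi)|)%:E <= K%:E)%E.
  apply: le_trans fK; apply: ereal_sup_ubound; exists (`|phi|^-1 *: phi) => //=.
  by rewrite normrZ ger0_norm ?invr_ge0// mulVf// gt_eqF.
by rewrite lee_fin fZ normrZ ger0_norm ?invr_ge0// ler_pdivrMl// mulrC.
Qed.

Variables (S : R -> {linear X -> X}) (K : R).
Hypothesis S_C0 : bounded_C0_semigroup S.
Hypothesis S_le : forall (t : R) phi, 0 <= t -> `|S t phi| <= K * `|phi|.
Hypothesis K_ge0 : 0 <= K.

(** A path y with y' = l(y) + defect, where l is the generator, stays near the
    semigroup orbit of y 0. This is the mean value inequality for
    s |-> S (T - s) (y s): a step from s to s' changes that function by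
    S (T - s') applied to y s' - S (s' - s) (y s), and the last vector is
    (s' - s) * defect up to o(s' - s), from the left as well as from the right. *)
Lemma near_orbit_of_defect (T rho : R) (y y' l : R -> X) :
  0 <= T ->
  (forall c : R, 0 <= c <= T -> h^-1 *: (y (c + h) - y c) @[h --> 0^'] --> y' c) ->
  (forall c : R, 0 <= c <= T -> h^-1 *: (S h (y c) - y c) @[h --> 0^'+] --> l c) ->
  (forall c : R, 0 <= c <= T -> `|y' c - l c| <= rho) ->
  `|y T - S T (y 0)| <= K * rho * T.
Proof.
move=> T0 yy' Sl ylrho.
suff est e : 0 < e -> `|y T - S T (y 0)| <= K * (rho + e) * T.
  apply/ler_addgt0Pr => e e0.
  have B0 : 0 < K * T + 1 by rewrite ltr_wpDl// mulr_ge0.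
  apply: (le_trans (est (e / (K * T + 1)) _)); first exact: divr_gt0.
  rewrite mulrDr mulrDl lerD2l mulrAC mulrA ler_pdivrMr// mulrC ler_wpM2l//; first exact: ltW.
  by rewrite lerDl.
move=> e0.
pose e1 := e / (K + 3).
have K3 : 0 < K + 3 by rewrite ltr_wpDl.
have e10 : 0 < e1 by exact: divr_gt0.
have e1E : K * e1 + e1 + e1 <= e.
  have -> : e = e1 * (K + 3) by rewrite /e1 divfK// gt_eqF.
  by move: (ltW e10); nra.
(* the first step continues the estimate past c, the second one reaches c *)
have local c : 0 <= c <= T -> exists2 d, 0 < d & forall h, 0 < h < d ->
    `|y (c + h) - S h (y c)| <= (rho + e) * h /\
    `|y c - S h (y (c - h))| <= (rho + e) * h.
  move=> cT.
  have [d1 d10 H1] := (cvg_dnbhsP _ _).1 (yy' c cT) e1 e10.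
  have [d2 d20 H2] := (cvg_rightP _ _).1 (Sl c cT) e1 e10.
  have [d3 d30 H3] := (cvg_rightP _ _).1 (@semigroup_C0 _ _ _ S_C0 (y' c)) e1 e10.
  exists (Num.min d1 (Num.min d2 d3)); first by rewrite !lt_min d10 d20 d30.
  move=> h; rewrite !lt_min => /and4P[h0 hd1 hd2 hd3].
  have hn0 : h != 0 by rewrite gt_eqF.
  have nh : `|h| = h by rewrite gtr0_norm.
  have := norm_quot hn0 (H1 h hn0 _); rewrite nh => /(_ hd1) A1.
  have := norm_quot _ (H1 (- h) _ _); rewrite oppr_eq0 normrN nh => /(_ hn0 hn0 hd1) A1'.
  have := norm_quot hn0 (H2 h _); rewrite nh h0 => /(_ hd2) A2.
  have A3 : `|y' c - S h (y' c)| <= e1 by apply: H3; rewrite h0.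
  have A4 : `|h *: (y' c - l c)| <= h * rho.
    by rewrite normrZ nh ler_wpM2l ?(ltW h0)// ylrho.
  have Ke : 0 <= K * e1 by rewrite mulr_ge0// ltW.
  split.
    have -> : y (c + h) - S h (y c) = (y (c + h) - y c - h *: y' c) +
        h *: (y' c - l c) - (S h (y c) - y c - h *: l c).
      rewrite scalerBr subrKA -!(addrA _ (- y c)) -opprD.
      by rewrite opprB addrA subrK.
    apply: (le_trans (ler_normB _ _)); apply: (le_trans (lerD (ler_normD _ _) (lexx _))).
    nra.
  have -> : y c - S h (y (c - h)) = - S h (y (c - h) - y c - (- h) *: y' c)
     - h *: (y' c - S h (y' c)) + h *: (y' c - l c) - (S h (y c) - y c - h *: l c).
    have SB u v : S h (u - v) = S h u - S h v by exact: linearB.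
    have SZ u : S h (h *: u) = h *: S h u by exact: linearZ.
    rewrite scaleNr opprK (linearD (S h)) SB SZ !scalerBr.
    move: (S h (y (c - h))) (S h (y c)) (h *: S h (y' c)) (h *: y' c) (h *: l c).
    move=> z u v a b; rewrite [- (a - v)]opprB -[X in X - _]addrA subrKA.
    rewrite opprD [- (z - u)]opprB (subrKA v) [- (_ - b)]opprB (subrKA b).
    by rewrite opprB [RHS]addrC (subrKA u).
  apply: (le_trans (ler_normB _ _)); apply: (le_trans (lerD (ler_normD _ _) (lexx _))).
  apply: (le_trans (lerD (lerD (ler_normB _ _) (lexx _)) (lexx _))).
  have : `|- S h (y (c - h) - y c - - h *: y' c)| <= K * (e1 * h).
    rewrite normrN; apply: (le_trans (S_le _ (ltW h0))); exact: ler_wpM2l.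
  have : `|h *: (y' c - S h (y' c))| <= h * e1.
    by rewrite normrZ nh ler_wpM2l ?(ltW h0).
  nra.
pose p s := S (T - s) (y s).
have pstep s s' : s <= s' <= T -> `|p s' - p s| <= K * `|y s' - S (s' - s) (y s)|.
  move=> /andP[ss' s'T]; rewrite /p.
  have -> : T - s = (T - s') + (s' - s) by rewrite addrA subrK.
  rewrite [S (_ + (s' - s)) _](semigroupD S_C0) ?subr_ge0// -linearB; apply: S_le.
  by rewrite subr_ge0.
have P (t : R) : 0 <= t <= T -> `|p t - p 0| <= K * (rho + e) * t.
  move: t; apply: real_induction => c cT Pc; have [d d0 Hd] := local c cT.
  have Pcc : `|p c - p 0| <= K * (rho + e) * c.
    have [->|cn0] := eqVneq c 0; first by rewrite subrr normr0 mulr0.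
    have c0 : 0 < c by rewrite lt_neqAle eq_sym cn0; case/andP: cT.
    pose h := Num.min (d / 2) c.
    have h0 : 0 < h by rewrite lt_min c0 divr_gt0.
    have hc : h <= c by rewrite ge_min lexx orbT.
    have hd : 0 < h < d.
      by rewrite h0 /h gt_min; apply/orP; left; rewrite ltr_pdivrMr// ltr_pMr// ltr1n.
    have [_ A] := Hd h hd.
    have B : `|p (c - h) - p 0| <= K * (rho + e) * (c - h).
      by apply: Pc; rewrite subr_ge0 hc/= gtrBl.
    have C := pstep (c - h) c; rewrite gerBl (ltW h0) in C.
    have {}C := C (proj2 (andP cT)); rewrite subKr in C.
    have -> : p c - p 0 = (p c - p (c - h)) + (p (c - h) - p 0) by rewrite addrA subrK.
    apply: (le_trans (ler_normD _ _)); apply: (le_trans (lerD C B)).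
    have := ler_wpM2l K_ge0 A; nra.
  exists d => // s /andP[cs sT] sd.
  have [->//|sc] := eqVneq s c.
  have [|A _] := Hd (s - c); first by rewrite subr_gt0 lt_neqAle eq_sym sc cs/= ltrBlDl.
  have C := pstep c s; rewrite cs sT in C; have {}C := C isT.
  have -> : p s - p 0 = (p s - p c) + (p c - p 0) by rewrite addrA subrK.
  apply: (le_trans (ler_normD _ _)); apply: (le_trans (lerD C Pcc)).
  rewrite subrKC in A; have := ler_wpM2l K_ge0 A; nra.
have := P T; rewrite T0 lexx /p subrr subr0 (semigroup0 S_C0) => /(_ isT).
by [].
Qed.

Local Notation mu := (@lebesgue_measure R).

(** Step function approximating x |-> S (t - x) w, where w is the generator at phi.
    Replacing w by its difference quotient with increment h, and the time by a
    multiple of h, makes the integrals of the steps telescope. *)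
Fixpoint orbit_steps (t h : R) (phi : X) (N : nat) :
    seq (set (measurableTypeR R) * X) :=
  if N is j.+1 then
    (`]t - j.+1%:R * h, t - j%:R * h]%classic,
     h^-1 *: S (j%:R * h) (S h phi - phi)) :: orbit_steps t h phi j
  else [::].

Lemma simple_int_orbit_steps t h phi N : 0 < h ->
  simple_int mu (orbit_steps t h phi N) = S (N%:R * h) phi - phi.
Proof.
move=> h0; elim: N => [|j IH].
  by rewrite /simple_int big_nil mul0r (semigroup0 S_C0) subrr.
rewrite /simple_int big_cons -/(simple_int mu _) IH /=.
have hn0 : h != 0 by rewrite gt_eqF.
have hS : t - j.+1%:R * h + h = t - j%:R * h by rewrite -natr1; ring.
rewrite lebesgue_measure_itv/= lte_fin -hS ltrDl h0 -EFinB addrAC subrr add0r/=.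
rewrite scalerA divff// scale1r linearB/=.
have -> : j.+1%:R * h = j%:R * h + h by rewrite -natr1; ring.
rewrite (semigroupD S_C0) ?mulr_ge0 ?(ltW h0)//.
by rewrite addrA subrK.
Qed.

Lemma simple_on_orbit_steps t h phi N : 0 < h -> N%:R * h <= t ->
  simple_on mu `[0, t]%classic (orbit_steps t h phi N).
Proof.
move=> h0; elim: N => [//|j IH] jt /=; split.
- exact: measurable_itv.
- move=> x /=; rewrite !in_itv/= => /andP[x1 x2]; apply/andP; split.
    by apply: le_trans (ltW x1); rewrite subr_ge0.
  by apply: (le_trans x2); rewrite gerBl mulr_ge0// ltW.
- by rewrite lebesgue_measure_itv/=; case: ifP => _; rewrite -?EFinB ltry.
- by apply: IH; apply: le_trans jt; rewrite ler_wpM2r ?(ltW h0)// ler_nat.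
Qed.

Lemma simple_val_orbit_steps t h phi w N e : 0 < h ->
  (forall r, 0 <= r < h -> `|S r w - h^-1 *: (S h phi - phi)| <= e) ->
  forall x, x <= t ->
    (x <= t - N%:R * h -> simple_val (orbit_steps t h phi N) x = 0) /\
    (t - N%:R * h < x ->
       `|S (t - x) w - simple_val (orbit_steps t h phi N) x| <= K * e).
Proof.
move=> h0 He x xt; elim: N => [|j [IH1 IH2]].
  split; first by rewrite /simple_val big_nil.
  by rewrite mul0r subr0 ltNge xt.
have jS : j.+1%:R * h = j%:R * h + h by rewrite -natr1; ring.
rewrite [orbit_steps _ _ _ _]/= simple_val_cons/= indicE; split => hx.
  rewrite memNset ?scale0r ?add0r; last first.
    by rewrite /= in_itv/= => /andP[]; rewrite ltNge hx.
  by apply: IH1; apply: (le_trans hx); rewrite jS; lra.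
have [xj|xj] := leP x (t - j%:R * h).
  rewrite mem_set; last by rewrite /= in_itv/= hx xj.
  rewrite IH1// scale1r addr0 -linearZ/=.
  have -> : t - x = j%:R * h + (t - x - j%:R * h) by ring.
  have j0 : 0 <= j%:R * h by rewrite mulr_ge0// ltW.
  have r0 : 0 <= t - x - j%:R * h by lra.
  rewrite (semigroupD S_C0)// -linearB; apply: (le_trans (S_le _ j0)).
  apply: ler_wpM2l => //; apply: He; rewrite r0/=.
  by move: hx; rewrite jS; lra.
rewrite memNset ?scale0r ?add0r; first exact: IH2.
by rewrite /= in_itv/= => /andP[_]; rewrite leNgt xj.
Qed.

(** The integral of x |-> S (t - x) w over [0, t] is S t phi - phi when w is the
    generator at phi. The approximating simple function has exactly this integral,
    and the estimate is uniform in x because S is bounded: only the behaviour of S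
    near 0 at phi and at w enters. *)
Lemma orbit_integral_approx (phi w : X) (t e : R) : 0 <= t -> 0 < e ->
  h^-1 *: (S h phi - phi) @[h --> 0^'+] --> w ->
  exists s, [/\ simple_on mu `[0, t]%classic s, simple_int mu s = S t phi - phi &
    forall x, 0 <= x <= t -> `|S (t - x) w - simple_val s x| <= e].
Proof.
move=> t0 e0 Sw.
pose e1 := e / (2 * (K + 1)).
have K1 : 0 < 2 * (K + 1) by rewrite mulr_gt0// ltr_wpDl.
have e10 : 0 < e1 by exact: divr_gt0.
have [d1 d10 H1] := (cvg_rightP _ _).1 Sw e1 e10.
have [d2 d20 H2] := (cvg_rightP _ _).1 (@semigroup_C0 _ _ _ S_C0 w) e1 e10.
pose d := Num.min d1 d2.
have d0 : 0 < d by rewrite lt_min d10.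
have [N [h [h0 hd Nh]]] : exists N h, [/\ 0 < h, h < d & N%:R * h = t].
  have [->|tn0] := eqVneq t 0.
    by exists 0%N, (d / 2); rewrite mul0r divr_gt0// ltr_pdivrMr// ltr_pMr// ltr1n.
  have tp : 0 < t by rewrite lt_neqAle eq_sym tn0.
  exists (Num.truncn (t / d)).+1, (t / (Num.truncn (t / d)).+1%:R); split.
  - exact: divr_gt0.
  - rewrite ltr_pdivrMr// mulrC -ltr_pdivrMr//; exact: truncnS_gt.
  - by rewrite mulrC divfK// pnatr_eq0.
have He r : 0 <= r < h -> `|S r w - h^-1 *: (S h phi - phi)| <= 2 * e1.
  move=> /andP[r0 rh].
  have -> : S r w - h^-1 *: (S h phi - phi) = - (w - S r w) + (w - h^-1 *: (S h phi - phi)).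
    by rewrite opprB addrA subrK.
  apply: (le_trans (ler_normD _ _)); rewrite normrN mulr2n mulrDl mul1r; apply: lerD.
    have [->|rn0] := eqVneq r 0.
      by rewrite (semigroup0 S_C0) subrr normr0 ltW.
    apply: H2; rewrite lt_neqAle eq_sym rn0 r0/= (lt_trans rh)// (lt_le_trans hd)//.
    by rewrite ge_min lexx orbT.
  by apply: H1; rewrite h0/= (lt_le_trans hd)// ge_min lexx.
have e1e : K * (2 * e1) <= e.
  have -> : e = e1 * (2 * (K + 1)) by rewrite /e1 divfK// gt_eqF.
  by move: (ltW e10); nra.
(* the half-open steps miss the left end point, which a null set takes care of *)
exists (([set 0], S t w) :: orbit_steps t h phi N); split.
- split.
  + exact: measurable_set1.
  + by move=> x ->; rewrite /= in_itv/= lexx.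
  + by rewrite /= lebesgue_measure_set1 ltry.
  + by apply: simple_on_orbit_steps => //; rewrite Nh.
- rewrite /simple_int big_cons/= lebesgue_measure_set1/= scale0r add0r.
  by rewrite -/(simple_int mu _) simple_int_orbit_steps// Nh.
- move=> x /andP[x0 xt]; rewrite simple_val_cons/= indicE.
  have [] := simple_val_orbit_steps N h0 He xt; rewrite Nh subrr => A B.
  have [x0'|xn0] := eqVneq x 0.
    rewrite x0' in A *; rewrite (A (lexx 0)).
    by rewrite mem_set// scale1r subr0 addr0 subrr normr0 ltW.
  rewrite memNset ?scale0r ?add0r; last by apply/eqP.
  apply: le_trans e1e; apply: B.
  by rewrite lt_neqAle eq_sym xn0.
Qed.

End Semigroup.

(** * Matrix exponentials *)

Section MatrixNorm.
Context (R : realType) (n : nat).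
Local Notation M := 'M[R[i]]_n.
Local Notation normc := (@ComplexField.Normc.normc R).
Implicit Types A B C : M.

(** Submultiplicative, and real-valued whereas the modulus on R[i] takes its values
    in R[i]; this allows comparison with real exponential series. *)
Definition l1norm A : R := \sum_i \sum_j normc (A i j).

Lemma normc_ge0 (z : R[i]) : 0 <= normc z.
Proof. by case: z => a b; exact: sqrtr_ge0. Qed.

Lemma norm_Re_le (z : R[i]) : `|complex.Re z| <= normc z.
Proof. by case: z => a b /=; rewrite -sqrtr_sqr ler_wsqrtr// lerDl sqr_ge0. Qed.

Lemma norm_Im_le (z : R[i]) : `|complex.Im z| <= normc z.
Proof. by case: z => a b /=; rewrite -sqrtr_sqr ler_wsqrtr// lerDr sqr_ge0. Qed.

Lemma normc_le_ReIm (z : R[i]) : normc z <= `|complex.Re z| + `|complex.Im z|.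
Proof.
case: z => a b /=; rewrite -[leRHS]ger0_norm ?addr_ge0// -sqrtr_sqr ler_wsqrtr//.
rewrite sqrrD !real_normK ?num_real// -addrA lerD2l lerDr.
by rewrite mulrn_wge0// mulr_ge0.
Qed.

Lemma l1norm_ge0 A : 0 <= l1norm A.
Proof. by apply: sumr_ge0 => i _; apply: sumr_ge0 => j _; exact: normc_ge0. Qed.

Lemma l1norm0 : l1norm 0 = 0.
Proof.
rewrite /l1norm big1// => i _; rewrite big1// => j _.
by rewrite mxE ComplexField.Normc.normc0.
Qed.

Lemma l1normN A : l1norm (- A) = l1norm A.
Proof.
by apply: eq_bigr => i _; apply: eq_bigr => j _; rewrite mxE normcN.
Qed.

Lemma l1normD A B : l1norm (A + B) <= l1norm A + l1norm B.
Proof.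
rewrite /l1norm -big_split; apply: ler_sum => i _ /=; rewrite -big_split.
by apply: ler_sum => j _ /=; rewrite mxE le_normcD.
Qed.

Lemma l1norm_sum (I : Type) (r : seq I) (P : pred I) (f : I -> M) :
  l1norm (\sum_(i <- r | P i) f i) <= \sum_(i <- r | P i) l1norm (f i).
Proof.
elim/big_ind2: _ => [|x1 x2 y1 y2 h1 h2|//]; first by rewrite l1norm0.
by apply: (le_trans (l1normD _ _)); exact: lerD.
Qed.

Lemma normc_sum (I : Type) (r : seq I) (f : I -> R[i]) :
  normc (\sum_(i <- r) f i) <= \sum_(i <- r) normc (f i).
Proof.
elim/big_ind2: _ => [|x1 x2 y1 y2 h1 h2|//]; first by rewrite ComplexField.Normc.normc0.
by apply: (le_trans (le_normcD _ _)); exact: lerD.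
Qed.

Lemma normc_le_l1norm A i j : normc (A i j) <= l1norm A.
Proof.
rewrite /l1norm (bigD1 i)//= (bigD1 j)//= -addrA lerDl addr_ge0//.
  by apply: sumr_ge0 => ? _; exact: normc_ge0.
by apply: sumr_ge0 => ? _; apply: sumr_ge0 => ? _; exact: normc_ge0.
Qed.

Lemma l1normM A B : l1norm (A * B) <= l1norm A * l1norm B.
Proof.
rewrite {1 2}/l1norm mulr_suml; apply: ler_sum => i _.
apply: (@le_trans _ _ (\sum_j \sum_k normc (A i k) * normc (B k j))).
  apply: ler_sum => j _; rewrite mxE; apply: (le_trans (normc_sum _ _)).
  by apply: ler_sum => k _; rewrite ComplexField.Normc.normcM.
rewrite exchange_big/= mulr_suml; apply: ler_sum => k _.
rewrite -mulr_sumr ler_wpM2l ?normc_ge0//.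
rewrite /l1norm [leRHS](bigD1 k)//= lerDl.
by apply: sumr_ge0 => ? _; apply: sumr_ge0 => ? _; exact: normc_ge0.
Qed.

Lemma l1norm_rscale (t : R) A : l1norm (rscale t A) = `|t| * l1norm A.
Proof.
rewrite /l1norm mulr_sumr; apply: eq_bigr => i _; rewrite mulr_sumr.
apply: eq_bigr => j _; rewrite mxE ComplexField.Normc.normcM; congr (_ * _).
by rewrite /= expr0n/= addr0 sqrtr_sqr.
Qed.

Lemma mx_cvg_of_norm (T : Type) (F : set_system T) {FF : Filter F} (f : T -> M) A :
  (forall e : R, 0 < e -> \forall x \near F, l1norm (A - f x) <= e) -> f @ F --> A.
Proof.
move=> H; apply/cvg_ballP => e e0.
have [e' e'0 ->] : exists2 e', 0 < e' & e = e'%:C%C.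
  move: e e0 => [a b]; rewrite ltcE/= => /andP[/eqP-> a0]; by exists a.
have e2 : 0 < e' / 2 by rewrite divr_gt0.
apply: filterS (H _ e2) => x Hx; split; first by rewrite ltcR.
move=> i j; rewrite /ball/=.
have -> : `|A i j - f x i j| = (normc ((A - f x) i j))%:C%C by rewrite !mxE.
rewrite ltcR; apply: (le_lt_trans (normc_le_l1norm _ _ _)); apply: (le_lt_trans Hx).
by rewrite ltr_pdivrMr// ltr_pMr// ltr1n.
Qed.

Lemma mx_hausdorff : hausdorff_space M.
Proof.
rewrite ball_hausdorff => A B AB.
have [i [j ABij]] : exists i j, A i j != B i j.
  apply: contrapT => H; case/eqP: AB; apply/matrixP => i j; apply/eqP.
  by apply: contrapT => /negP ABij; apply: H; exists i, j.
have d0 : 0 < `|A i j - B i j| / 2.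
  by rewrite divr_gt0// normr_gt0 subr_eq0.
exists (PosNum d0, PosNum d0) => /=; apply/eqP; rewrite -subset0 => D.
move=> [[_ /(_ i j) AD] [_ /(_ i j) BD]].
move: AD BD; rewrite /ball/= => AD BD.
have : `|A i j - B i j| < `|A i j - B i j|; last by rewrite ltxx.
apply: (le_lt_trans (ler_distD (D i j) (A i j) (B i j))).
by rewrite [ltRHS]splitr ltrD// distrC.
Qed.

Definition mcvg (u : nat -> M) (l : M) := l1norm (l - u k) @[k --> \oo] --> (0 : R).

Lemma mcvg_lim u l : mcvg u l -> limn u = l.
Proof.
move=> ul; apply: cvg_lim; first exact: mx_hausdorff.
apply: mx_cvg_of_norm => e e0; move/cvgrPdist_le: ul => /(_ e e0).
by apply: filterS => k; rewrite sub0r normrN ger0_norm//; exact: l1norm_ge0.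
Qed.

(** Completeness of the complex matrices, reduced to that of R through the real and
    imaginary parts of the entries, which are Cauchy sequences. *)
Lemma mcvg_dominated (u : nat -> M) (c : nat -> R) : cvgn c ->
  (forall p k, l1norm (u p - u k) <= `|c p - c k|) -> exists l, mcvg u l.
Proof.
move=> cc uc.
have dom (w : nat -> R) : (forall p k, `|w p - w k| <= `|c p - c k|) -> cvgn w.
  move=> wc; apply/cauchy_cvgP.
  have /cauchy_ballP cC : cauchy (c @ \oo) by exact: cvg_cauchy.
  apply/cauchy_ballP => e e0; have {}cC := cC e e0; move: cC.
  rewrite !near_map2; apply: filterS => -[p k] /=.
  by rewrite /ball/=; apply: le_lt_trans.
have uij p k i j : u p i j - u k i j = (u p - u k) i j by rewrite !mxE.
have ReC i j : cvgn (fun k => complex.Re (u k i j)).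
  apply: dom => p k; apply: le_trans (uc p k); rewrite -raddfB uij.
  exact: le_trans (norm_Re_le _) (normc_le_l1norm _ _ _).
have ImC i j : cvgn (fun k => complex.Im (u k i j)).
  apply: dom => p k; apply: le_trans (uc p k); rewrite -raddfB uij.
  exact: le_trans (norm_Im_le _) (normc_le_l1norm _ _ _).
exists (\matrix_(i, j) (limn (fun k => complex.Re (u k i j)) +i*
                        limn (fun k => complex.Im (u k i j)))%C).
rewrite /mcvg; apply/cvgrPdist_le => e e0.
pose e1 := e / (n * n * 2).+1%:R.
have e10 : 0 < e1 by rewrite divr_gt0.
have near_ij : \forall k \near \oo, forall i j : 'I_n,
    `|limn (fun k => complex.Re (u k i j)) - complex.Re (u k i j)| <= e1 /\
    `|limn (fun k => complex.Im (u k i j)) - complex.Im (u k i j)| <= e1.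
  apply: filter_forall => i; apply: filter_forall => j.
  apply: filterI; first exact: (cvgrPdist_le _ _).1 (ReC i j) _ e10.
  exact: (cvgrPdist_le _ _).1 (ImC i j) _ e10.
apply: filterS near_ij => k Hk; rewrite sub0r normrN ger0_norm ?l1norm_ge0//.
apply: (@le_trans _ _ (\sum_(i < n) \sum_(j < n) (e1 + e1))).
  apply: ler_sum => i _; apply: ler_sum => j _; rewrite !mxE.
  have [h1 h2] := Hk i j; apply: le_trans (normc_le_ReIm _) _.
  by rewrite !raddfB /= lerD.
rewrite !sumr_const !card_ord -!mulrnA -mulr2n -mulrnA.
rewrite -[leLHS]mulr_natr /e1 -mulrA ler_piMr ?(ltW e0)//.
rewrite ler_pdivrMl// mulr1 ler_nat; nia.
Qed.

End MatrixNorm.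

Section MatrixExponential.
Context (R : realType) (n : nat).
Local Notation M := 'M[R[i]]_n.
Implicit Types (A B C X Y : M) (s t : R).

Lemma rscaleDr t A B : rscale t (A + B) = rscale t A + rscale t B.
Proof. exact: scalerDr. Qed.

Lemma rscaleDl s t A : rscale (s + t) A = rscale s A + rscale t A.
Proof. by rewrite /rscale rmorphD scalerDl. Qed.

Lemma rscaleA s t A : rscale s (rscale t A) = rscale (s * t) A.
Proof. by rewrite /rscale scalerA rmorphM. Qed.

Lemma rscale1 A : rscale 1 A = A.
Proof. by rewrite /rscale rmorph1 scale1r. Qed.

Lemma rscale0 A : rscale 0 A = 0.
Proof. by rewrite /rscale rmorph0 scale0r. Qed.

Lemma rscaleN t A : rscale (- t) A = - rscale t A.
Proof. by rewrite /rscale rmorphN scaleNr. Qed.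

Lemma rscale_sum t (I : Type) (r : seq I) (P : pred I) (f : I -> M) :
  rscale t (\sum_(i <- r | P i) f i) = \sum_(i <- r | P i) rscale t (f i).
Proof. exact: scaler_sumr. Qed.

Lemma rscaleMl t A B : rscale t A * B = rscale t (A * B).
Proof. exact/esym/scalemxAl. Qed.

Lemma rscaleMr t A B : A * rscale t B = rscale t (A * B).
Proof. exact/esym/scalemxAr. Qed.

Lemma rscale_inj t A B : t != 0 -> rscale t A = rscale t B -> A = B.
Proof.
move=> t0 /(congr1 (rscale t^-1)); rewrite !rscaleA mulVf// !rscale1; exact.
Qed.

Lemma mcvg_unique (u : nat -> M) A B : mcvg u A -> mcvg u B -> A = B.
Proof. by move=> /mcvg_lim <- /mcvg_lim. Qed.

Lemma mcvg_cst A : mcvg (fun=> A) A.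
Proof. by rewrite /mcvg subrr l1norm0; exact: cvg_cst. Qed.

Lemma mcvg_near (u v : nat -> M) A : mcvg u A ->
  l1norm (u k - v k) @[k --> \oo] --> (0 : R) -> mcvg v A.
Proof.
move=> uA uv.
apply: (@squeeze_cvgr _ _ _ _ (cst 0) (fun k => l1norm (A - u k) + l1norm (u k - v k))).
- apply: nearW => k; rewrite l1norm_ge0/=; apply: le_trans (l1normD _ _).
  by rewrite addrA subrK.
- exact: cvg_cst.
- by rewrite -[X in _ --> X](addr0 0); apply: cvgD.
Qed.

Lemma mcvgM (u v : nat -> M) A B : mcvg u A -> mcvg v B ->
  mcvg (fun k => u k * v k) (A * B).
Proof.
move=> uA vB.
apply: (@squeeze_cvgr _ _ _ _ (cst 0) (fun k => l1norm (A - u k) * l1norm (B - v k) +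
   l1norm A * l1norm (B - v k) + l1norm (A - u k) * l1norm B)).
- apply: nearW => k; rewrite l1norm_ge0/=.
  have -> : A * B - u k * v k = - ((A - u k) * (B - v k)) + A * (B - v k) + (A - u k) * B.
    rewrite [RHS]addrAC [- _ + _]addrC -mulrBr subKr mulrBl mulrBr.
    by rewrite [RHS]addrC (subrKA (A * v k)).
  apply: (le_trans (l1normD _ _)); apply: lerD; last exact: l1normM.
  apply: (le_trans (l1normD _ _)); apply: lerD; last exact: l1normM.
  by rewrite l1normN; exact: l1normM.
- exact: cvg_cst.
- rewrite [X in _ --> X](_ : 0 = 0 * 0 + l1norm A * 0 + 0 * l1norm B); last first.
    by rewrite !mul0r mulr0 !addr0.
  apply: cvgD; first apply: cvgD.
  + exact: cvgM.
  + by apply: cvgM => //; exact: cvg_cst.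
  + by apply: cvgM => //; exact: cvg_cst.
Qed.

Definition expc A k : M := rscale (k`!%:R)^-1 (A ^+ k).

Lemma l1norm_expc A k : l1norm (expc A k) <= l1norm (1 : M) * exp_coeff (l1norm A) k.
Proof.
rewrite /expc l1norm_rscale ger0_norm ?invr_ge0// exp_coeffE mulrCA ler_wpM2l ?invr_ge0//.
elim: k => [|k IH]; first by rewrite !expr0 mulr1.
rewrite exprSr exprSr mulrA; apply: (le_trans (l1normM _ _)).
by rewrite ler_wpM2r ?l1norm_ge0.
Qed.

Lemma series_mcvg (f : nat -> M) (a b : R) : 0 <= a ->
  (forall k, l1norm (f k) <= b * exp_coeff a k) -> mcvg (series f) (limn (series f)).
Proof.
move=> a0 fab.
have est p k : (k <= p)%N -> l1norm (series f p - series f k) <=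
    `|b * series (exp_coeff a) p - b * series (exp_coeff a) k|.
  move=> kp; rewrite -mulrBr !sub_series_geq//.
  apply: le_trans (ler_norm _); rewrite mulr_sumr.
  by apply: (le_trans (l1norm_sum _ _ _)); apply: ler_sum.
have [l fl] : exists l, mcvg (series f) l.
  apply: (@mcvg_dominated _ _ _ (fun k => b * series (exp_coeff a) k)).
    by apply: is_cvgM; [exact: is_cvg_cst|exact: is_cvg_series_exp_coeff].
  move=> p k; case: (leqP k p) => [|/ltnW] kp; first exact: est.
  by rewrite -l1normN opprB distrC; exact: est.
by rewrite (mcvg_lim fl).
Qed.

Lemma expm_mcvg A : mcvg (series (expc A)) (expm A).
Proof. exact: (series_mcvg (l1norm_ge0 A) (l1norm_expc A)). Qed.

Lemma expc_succl A k : rscale k.+1%:R (expc A k.+1) = A * expc A k.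
Proof.
rewrite /expc rscaleA rscaleMr exprS factS natrM invfM mulrA divff ?mul1r//.
Qed.

Lemma expc_succr A k : rscale k.+1%:R (expc A k.+1) = expc A k * A.
Proof. by rewrite expc_succl /expc rscaleMr rscaleMl -exprS -exprSr. Qed.

(** Degree k part of the product of the exponential series of A and B, with C in
    the middle. *)
Definition expc_prod A C B k : M :=
  \sum_(i < k.+1) expc A (k - i)%N * C * expc B i.

Lemma expc0 A : expc A 0 = 1.
Proof. by rewrite /expc fact0 invr1 rscale1 expr0. Qed.

Lemma expc_prod0 A C B : expc_prod A C B 0 = C.
Proof. by rewrite /expc_prod big_ord1 !expc0 mul1r mulr1. Qed.

(** The Leibniz rule for t |-> exp(tA) C exp(tB), read off the coefficients. Together
    with the value at k = 0 it determines the sequence. *)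
Lemma expc_prodS A C B k :
  rscale k.+1%:R (expc_prod A C B k.+1) = A * expc_prod A C B k + expc_prod A C B k * B.
Proof.
have -> : rscale k.+1%:R (expc_prod A C B k.+1) =
   \sum_(i < k.+2) rscale (k.+1 - i)%N%:R (expc A (k.+1 - i)%N) * C * expc B i +
   \sum_(i < k.+2) expc A (k.+1 - i)%N * C * rscale i%:R (expc B i).
  rewrite -big_split rscale_sum; apply: eq_bigr => i _ /=.
  move: (expc A _) (expc B _) => x y.
  by rewrite !rscaleMl rscaleMr -rscaleDl -natrD subnK// -ltnS ltn_ord.
congr (_ + _).
  rewrite big_ord_recr/= subnn rscale0 !mul0r addr0 mulr_sumr.
  apply: eq_bigr => i _; rewrite subSn ?expc_succl ?mulrA// -ltnS; exact: ltn_ord.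
rewrite big_ord_recl/= rscale0 mulr0 add0r mulr_suml.
by apply: eq_bigr => i _; rewrite subSS expc_succr mulrA.
Qed.

Lemma triangle_sum (V : nmodType) (g : nat -> nat -> V) N :
  \sum_(0 <= k < N) \sum_(i < k.+1) g i (k - i)%N =
  \sum_(i < N) \sum_(0 <= j < N - i) g i j.
Proof.
elim: N => [|N IH]; first by rewrite big_geq// big_ord0.
rewrite big_nat_recr//= IH.
have -> : \sum_(i < N) \sum_(0 <= j < N - i) g i j = \sum_(i < N.+1) \sum_(0 <= j < N - i) g i j.
  by rewrite big_ord_recr/= subnn [X in _ + X]big_geq// addr0.
rewrite -big_split; apply: eq_bigr => i _ /=.
by rewrite subSn ?big_nat_recr// -ltnS; exact: ltn_ord.
Qed.

Lemma square_sum (V : nmodType) (g : nat -> nat -> V) N :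
  \sum_(i < N) \sum_(0 <= j < N) g i j =
  \sum_(0 <= k < N) \sum_(i < k.+1) g i (k - i)%N +
  \sum_(i < N) \sum_(N - i <= j < N) g i j.
Proof.
rewrite triangle_sum -big_split; apply: eq_bigr => i _ /=.
by rewrite -big_cat_nat//= leq_subr.
Qed.

Lemma exp_coeff_prod (a b : R) k :
  \sum_(i < k.+1) exp_coeff a (k - i)%N * exp_coeff b i = exp_coeff (a + b) k.
Proof.
rewrite !exp_coeffE/= exprDn mulr_sumr; apply: eq_bigr => i _.
have ik : (i <= k)%N by rewrite -ltnS; exact: ltn_ord.
have := bin_fact ik => /(congr1 (fun m => m%:R : R)); rewrite !natrM => <-.
have f1 : i`!%:R != 0 :> R by rewrite pnatr_eq0 -lt0n fact_gt0.
have f2 : (k - i)%N`!%:R != 0 :> R by rewrite pnatr_eq0 -lt0n fact_gt0.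
have f3 : 'C(k, i)%:R != 0 :> R by rewrite pnatr_eq0 -lt0n bin_gt0.
move: (a ^+ _) (b ^+ _) f1 f2 f3 => u v.
rewrite -[u * v *+ _]mulr_natr.
by move: (i`!%:R) ((k - i)%N`!%:R) ('C(k, i)%:R) => x y z x0 y0 z0; field; rewrite x0 y0 z0.
Qed.

(** The product of two partial sums exceeds the partial sum of the Cauchy product by
    the terms of degrees (i, j) with i + j >= N. In norm these are at most the
    corresponding terms for the real exponentials of the norms, whose sum tends to
    expR a * expR b - expR (a + b) = 0. *)
Lemma expc_prod_mcvg A C B :
  mcvg (series (expc_prod A C B)) (expm A * C * expm B).
Proof.
pose a := l1norm A; pose b := l1norm B; pose e (x : R) := series (exp_coeff x).
have a0 : 0 <= a by exact: l1norm_ge0. have b0 : 0 <= b by exact: l1norm_ge0.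
apply: (mcvg_near (mcvgM (mcvgM (expm_mcvg A) (mcvg_cst C)) (expm_mcvg B))).
pose m := l1norm (1 : M) * l1norm C * l1norm (1 : M).
apply: (@squeeze_cvgr _ _ _ _ (cst 0) (fun N => m * (e a N * e b N - e (a + b) N))).
- apply: nearW => N; rewrite l1norm_ge0/=.
  have -> : series (expc A) N * C * series (expc B) N =
      \sum_(i < N) \sum_(0 <= j < N) expc A j * C * expc B i.
    rewrite /series/= [X in _ * X]big_mkord mulr_sumr; apply: eq_bigr => i _.
    by rewrite !mulr_suml.
  rewrite (square_sum (fun i j => expc A j * C * expc B i)) addrAC subrr add0r.
  have -> : e a N * e b N = \sum_(i < N) \sum_(0 <= j < N) exp_coeff a j * exp_coeff b i.
    rewrite /e /series/= [X in _ * X]big_mkord mulr_sumr; apply: eq_bigr => i _.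
    by rewrite mulr_suml.
  rewrite (square_sum (fun i j => exp_coeff a j * exp_coeff b i)).
  rewrite [X in (X + _) - _](_ : _ = e (a + b) N); last first.
    by rewrite /e /series/=; apply: eq_bigr => k _; rewrite exp_coeff_prod.
  rewrite addrAC subrr add0r mulr_sumr.
  apply: (le_trans (l1norm_sum _ _ _)); apply: ler_sum => i _; rewrite mulr_sumr.
  apply: (le_trans (l1norm_sum _ _ _)); apply: ler_sum => j _.
  apply: (le_trans (l1normM _ _)).
  have -> : m * (exp_coeff a j * exp_coeff b i) =
    (l1norm (1 : M) * exp_coeff a j) * l1norm C * (l1norm (1 : M) * exp_coeff b i).
    by rewrite /m; ring.
  apply: ler_pM; rewrite ?l1norm_ge0 ?l1norm_expc//.
  by apply: (le_trans (l1normM _ _)); rewrite ler_wpM2r ?l1norm_ge0 ?l1norm_expc.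
- exact: cvg_cst.
- rewrite [X in _ --> X](_ : 0 = m * (expR a * expR b - expR (a + b))); last first.
    by rewrite expRD subrr mulr0.
  apply: cvgM; first exact: cvg_cst.
  have ec x : e x @ \oo --> expR x by exact: is_cvg_series_exp_coeff.
  by apply: cvgB => //; apply: cvgM.
Qed.

(** With A = sX, C = 1, B = tX this gives the one-parameter group law; with
    A = -tX, B = tX it identifies the exponential of a bracket operator with a
    conjugation. *)
Lemma limn_series_exp_rec A C B (p : nat -> M) : p 0%N = C ->
  (forall k, rscale k.+1%:R (p k.+1) = A * p k + p k * B) ->
  limn (series p) = expm A * C * expm B.
Proof.
move=> p0 pS; have -> : p = expc_prod A C B.
  apply/funext; elim=> [|k IH]; first by rewrite p0 expc_prod0.
  by apply: (@rscale_inj k.+1%:R); rewrite ?pnatr_eq0// pS expc_prodS IH.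
exact: mcvg_lim (expc_prod_mcvg A C B).
Qed.

Lemma expm_rscaleD s t X :
  expm (rscale (s + t) X) = expm (rscale s X) *m expm (rscale t X).
Proof.
rewrite -[expm (rscale s X)]mulr1.
apply: (@limn_series_exp_rec _ 1 _ (expc (rscale (s + t) X))) => [|k]; first exact: expc0.
rewrite expc_succl [X in X * _ = _]rscaleDl mulrDl; congr (_ + _).
have cX : X * expc (rscale (s + t) X) k = expc (rscale (s + t) X) k * X.
  rewrite /expc rscaleMr rscaleMl; congr (rscale _ _); apply: commrX.
  by rewrite /GRing.comm rscaleMr rscaleMl.
exact: etrans (rscaleMl _ _ _) (etrans (congr1 (rscale t) cX) (esym (rscaleMr _ _ _))).
Qed.

Lemma l1norm_expm_sub1 X : l1norm (expm X - 1) <= l1norm (1 : M) * (expR (l1norm X) - 1).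
Proof.
have lim1 : l1norm (expm X - series (expc X) k.+1) @[k --> \oo] --> (0 : R).
  by have := expm_mcvg X; rewrite /mcvg -cvg_shiftS.
have lim2 : l1norm (1 : M) * (series (exp_coeff (l1norm X)) k.+1 - 1) @[k --> \oo] -->
    l1norm (1 : M) * (expR (l1norm X) - 1).
  apply: cvgM; first exact: cvg_cst.
  apply: cvgB; last exact: cvg_cst.
  have : series (exp_coeff (l1norm X)) @ \oo --> expR (l1norm X) by exact: is_cvg_series_exp_coeff.
  by rewrite -cvg_shiftS.
rewrite -[leRHS]add0r; apply: (ler_cvg_to (cvg_cst _) (cvgD lim1 lim2)).
apply: nearW => k.
have -> : expm X - 1 = (expm X - series (expc X) k.+1) + (series (expc X) k.+1 - 1).
  by rewrite addrA subrK.
apply: (le_trans (l1normD _ _)); rewrite lerD2l.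
rewrite /series/= !big_nat_recl//= expc0 addrAC subrr add0r.
have -> : exp_coeff (l1norm X) 0%N = 1 by rewrite exp_coeffE/= fact0 expr0 invr1 mulr1.
rewrite addrAC subrr add0r.
rewrite mulr_sumr; apply: (le_trans (l1norm_sum _ _ _)); apply: ler_sum => i _.
exact: l1norm_expc.
Qed.

Lemma expm0 : expm (0 : M) = 1%:M.
Proof.
have : l1norm (expm (0 : M) - 1) <= 0.
  by apply: (le_trans (l1norm_expm_sub1 _)); rewrite l1norm0 expR0 subrr mulr0.
move=> h; apply/eqP; rewrite -subr_eq0; apply/eqP/matrixP => i j.
rewrite [RHS]mxE; apply: ComplexField.Normc.eq0_normc; apply/eqP.
by rewrite eq_le normc_ge0 andbT; apply: le_trans (normc_le_l1norm _ _ _) h.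
Qed.

(** The recurrence holds because t [Z, X] = (- t X) Z + Z (t X). *)
Lemma exp_op_bracket t X Y :
  exp_op (fun Z => rscale t (bracket Z X)) Y =
  expm (rscale (- t) X) *m Y *m expm (rscale t X).
Proof.
apply: limn_series_exp_rec => [|k]; first by rewrite fact0 invr1 rscale1.
rewrite rscaleA factS natrM invfM mulrA divff ?mul1r ?pnatr_eq0//=.
set Z := iter k _ Y; set c := _^-1.
have -> : rscale (- t) X * rscale c Z = rscale c (- rscale t (X * Z)).
  by rewrite rscaleMr rscaleMl rscaleN.
have -> : rscale c Z * rscale t X = rscale c (rscale t (Z * X)).
  by rewrite rscaleMr rscaleMl !rscaleA mulrC.
by rewrite -rscaleDr addrC; congr (rscale c _); exact: scalerBr.
Qed.

Lemma expm_conj (g X : M) : g \in unitmx ->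
  expm (invmx g *m X *m g) = invmx g *m expm X *m g.
Proof.
move=> gu; apply: mcvg_unique (expm_mcvg _) _.
have -> : series (expc (invmx g *m X *m g)) = (fun N => invmx g * series (expc X) N * g).
  apply/funext => N; rewrite /series/= mulr_sumr mulr_suml; apply: eq_bigr => k _.
  rewrite /expc rscaleMr rscaleMl; congr (rscale _ _).
  elim: k => [|k IH]; first by rewrite !expr0 mulr1; exact/esym/mulVmx.
  by rewrite exprSr IH exprSr -!mulmxE !mulmxA (mulmxK gu).
by apply: mcvgM; [apply: mcvgM; [exact: mcvg_cst|exact: expm_mcvg]|exact: mcvg_cst].
Qed.

Lemma expm_rscale_cvg0 X : expm (rscale h X) @[h --> (0 : R)] --> (1%:M : M).
Proof.
apply: mx_cvg_of_norm => e e0.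
pose b := l1norm (1 : M); pose a := l1norm X.
have b0 : 0 <= b by exact: l1norm_ge0.
have a0 : 0 <= a by exact: l1norm_ge0.
have eb : 0 < e / (b + 1) by rewrite divr_gt0// ltr_wpDl.
have [d /= d0 Hd] : nbhs_ball (0 : R) [set x | `|expR 0 - expR x| <= e / (b + 1)].
  by apply/nbhs_ballP; apply: (cvgrPdist_le _ _).1 (@continuous_expR R 0) _ eb.
apply/nbhs_ballP; exists (d / (a + 1)) => /=; first by rewrite divr_gt0// ltr_wpDl.
move=> h; rewrite /ball/= sub0r normrN ltr_pdivlMr ?ltr_wpDl// => hd.
have ha : `|h| * a < d by apply: le_lt_trans hd; rewrite ler_wpM2l// lerDl.
have := Hd (`|h| * a); rewrite /ball/= sub0r normrN ger0_norm ?mulr_ge0// => /(_ ha).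
rewrite expR0 distrC => exp_le.
rewrite -l1normN opprB; apply: (le_trans (l1norm_expm_sub1 _)).
rewrite l1norm_rscale -/a -/b; apply: (@le_trans _ _ (b * (e / (b + 1)))).
  by rewrite ler_wpM2l//; apply: le_trans exp_le; exact: ler_norm.
by rewrite mulrCA ler_piMr ?(ltW e0)// ler_pdivrMr ?mul1r ?lerDl// ltr_wpDl.
Qed.

End MatrixExponential.

(** * The symmetry group and its action *)

Lemma cvg_eqfun (T : Type) (U : topologicalType) (B : set_system T) (f g : T -> U) (l : U) :
  f =1 g -> f @ B --> l -> g @ B --> l.
Proof. by move=> /funext ->. Qed.

Lemma quotient_comp (R : realType) (X : normedModType R) (f g : {linear X -> X})
  (a : R) (x y : X) :
  f (g (a *: (x - y))) + a *: (f (g y) - g y) = a *: (f (g x) - g y).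
Proof.
by rewrite !linearZ/= !linearB/= addrA subrK.
Qed.

Section Symmetry.
Context (R : realType) (X : normedModType R) (n : nat).
Local Notation M := 'M[R[i]]_n.
Context (DA : set X) (A F : X -> X) (G : set M) (Pi : M -> {linear X -> X}).
Hypotheses (G_Lie : matrix_Lie_group G) (Pi_symm : symmetry_group G Pi DA A F).
Implicit Types (g : M) (Y : M) (phi : X).

Lemma mxgroup_expm Y t : Lie_algebra G Y -> G (expm (rscale t Y)).
Proof. exact. Qed.

Lemma mxgroup_expm1 Y : Lie_algebra G Y -> G (expm Y).
Proof. by move=> gY; have := mxgroup_expm 1 gY; rewrite rscale1. Qed.

Lemma Pi_invK g phi : G g -> Pi (invmx g) (Pi g phi) = phi.
Proof.
move=> Gg; rewrite -(symmM Pi_symm)//; last exact: (mxgroupV G_Lie).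
by rewrite mulVmx ?(symm1 Pi_symm)//; exact: (mxgroup_unit G_Lie).
Qed.

Lemma Pi_Kinv g phi : G g -> Pi g (Pi (invmx g) phi) = phi.
Proof.
move=> Gg; rewrite -(symmM Pi_symm)//; last exact: (mxgroupV G_Lie).
by rewrite mulmxV ?(symm1 Pi_symm)//; exact: (mxgroup_unit G_Lie).
Qed.

Lemma expm_rscaleN_mul Y t : expm (rscale (- t) Y) *m expm (rscale t Y) = 1%:M.
Proof. by rewrite -expm_rscaleD addNr rscale0 expm0. Qed.

Lemma Pi_expmK Y t phi : Lie_algebra G Y ->
  Pi (expm (rscale (- t) Y)) (Pi (expm (rscale t Y)) phi) = phi.
Proof.
move=> gY; rewrite -(symmM Pi_symm); try exact: mxgroup_expm.
by rewrite expm_rscaleN_mul (symm1 Pi_symm).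
Qed.

Lemma Pi_expmNK Y t phi : Lie_algebra G Y ->
  Pi (expm (rscale t Y)) (Pi (expm (rscale (- t) Y)) phi) = phi.
Proof. by move=> gY; rewrite -{1}(opprK t) Pi_expmK. Qed.

Lemma Lie_algebra_conj g Y : G g -> Lie_algebra G Y ->
  Lie_algebra G (invmx g *m Y *m g).
Proof.
move=> Gg gY t; have gu := mxgroup_unit G_Lie Gg.
rewrite /rscale scalemxAl scalemxAr expm_conj//.
by apply: (mxgroupM G_Lie) => //; apply: (mxgroupM G_Lie); [exact: (mxgroupV G_Lie)|exact: gY].
Qed.

Lemma Pi_expm_cvg0 Y phi : Lie_algebra G Y ->
  Pi (expm (rscale h Y)) phi @[h --> (0 : R)] --> phi.
Proof.
move=> gY; have := (subspace_continuousP _ _).1 (symm_strong Pi_symm (phi := phi)).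
move=> /(_ _ (mxgroup1 G_Lie)) H.
have lim : expm (rscale h Y) @[h --> (0 : R)] --> within G (nbhs (1%:M : M)).
  move=> B; rewrite /within/= => nB.
  have E : \forall h \near (0 : R), G (expm (rscale h Y)) -> B (expm (rscale h Y)).
    exact: expm_rscale_cvg0 Y _ nB.
  change (\forall h \near (0 : R), B (expm (rscale h Y))).
  by apply: filterS E => h; apply; exact: gY.
by rewrite -[X in _ --> X](symm1 Pi_symm); exact: cvg_comp lim H.
Qed.

Lemma F_Pi g phi : G g -> F (Pi g phi) = Pi g (F phi).
Proof. by move=> Gg; rewrite (symm_F Pi_symm _ Gg) Pi_invK. Qed.

Lemma A_Pi g phi : G g -> DA phi -> A (Pi g phi) = Pi g (A phi).
Proof.
by move=> Gg Dphi; rewrite (symm_A Pi_symm Gg (symm_dom Pi_symm Gg Dphi)) Pi_invK.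
Qed.

(** The chain rule for F = Pi g F (Pi g)^-1. *)
Lemma diff_F_Pi g phi psi : G g -> differentiable F phi ->
  'd F (Pi g phi) psi = Pi g ('d F phi (Pi (invmx g) psi)).
Proof.
move=> Gg dF.
have GV := mxgroupV G_Lie Gg.
have c1 := symm_continuous Pi_symm Gg; have c2 := symm_continuous Pi_symm GV.
have FE : F = (Pi g \o F) \o Pi (invmx g).
  by apply/funext => x /=; rewrite -F_Pi// Pi_Kinv.
rewrite {1}FE diff_comp; last 2 first.
- exact: linear_differentiable.
- apply: differentiable_comp; first by rewrite Pi_invK.
  exact: linear_differentiable.
rewrite diff_comp; [|by rewrite Pi_invK|exact: linear_differentiable].
by rewrite /= Pi_invK// diff_lin// diff_lin.
Qed.

Lemma dPi_quot_cvg Y phi : dPi_dom Pi Y phi ->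
  dPi_quot Pi Y phi t @[t --> 0^'] --> dPi Pi Y phi.
Proof. by []. Qed.

(** Conjugating by g turns the one-parameter group of Y into that of g^-1 Y g, so
    the group orbit of a vector in the domains of all dPi Y stays in these
    domains. *)
Lemma dPi_dom_Pi g Y phi : G g -> Lie_algebra G Y ->
  dPi_dom Pi (invmx g *m Y *m g) phi -> dPi_dom Pi Y (Pi g phi).
Proof.
move=> Gg gY /cvg_ex[/= l Hl]; apply/cvg_ex; exists (Pi g l).
have -> : dPi_quot Pi Y (Pi g phi) = Pi g \o dPi_quot Pi (invmx g *m Y *m g) phi.
  apply/funext => t /=; rewrite /dPi_quot [RHS]linearZ/=; congr (_ *: _).
  rewrite [RHS]linearB/=; congr (_ - _).
  rewrite /rscale scalemxAl scalemxAr expm_conj ?(mxgroup_unit G_Lie)//.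
  have GV := mxgroupV G_Lie Gg; have Ge := mxgroup_expm t gY.
  by rewrite !(symmM Pi_symm)// ?Pi_Kinv//; exact: (mxgroupM G_Lie).
apply: cvg_comp Hl _; exact: (symm_continuous Pi_symm Gg).
Qed.

Variable K : R.
Hypothesis Pi_le : forall g phi, G g -> `|Pi g phi| <= K * `|phi|.
Hypothesis K_ge0 : 0 <= K.

Lemma Pi_expm_cvg_joint Y (f : R -> X) (l : X) : Lie_algebra G Y ->
  f h @[h --> 0^'] --> l -> Pi (expm (rscale (- h) Y)) (f h) @[h --> 0^'] --> l.
Proof.
move=> gY /cvg_dnbhsP fl; apply/cvg_dnbhsP => e e0.
pose e1 := e / (K + 1).
have e10 : 0 < e1 by rewrite divr_gt0// ltr_wpDl.
have [d1 d10 H1] := fl e1 e10.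
have [d2 /= d20 H2] := (nbhs_ballP _ _).1
  ((cvgrPdist_le _ _).1 (Pi_expm_cvg0 (Y := Y) (phi := l) gY) e1 e10).
exists (Num.min d1 d2); first by rewrite lt_min d10.
move=> h h0; rewrite lt_min => /andP[hd1 hd2].
have -> : l - Pi (expm (rscale (- h) Y)) (f h) =
    (l - Pi (expm (rscale (- h) Y)) l) + Pi (expm (rscale (- h) Y)) (l - f h).
  by rewrite linearB/= addrA subrK.
have -> : e = e1 + K * e1.
  by rewrite -[X in X + _]mul1r -mulrDl /e1 addrC mulrC divfK// gt_eqF// ltr_wpDl.
apply: (le_trans (ler_normD _ _)); apply: lerD.
  by apply: H2; rewrite /ball/= sub0r opprK.
apply: (le_trans (Pi_le _ (mxgroup_expm (- h) gY))).
by rewrite ler_wpM2l//; exact: H1.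
Qed.

Context (X0 : M) (ustar : X).
Hypotheses (X0_g : Lie_algebra G X0) (ustar_X0 : dPi_dom Pi X0 ustar).
Local Notation E t := (expm (rscale t X0)).

(** In the frame moving with exp(t X0), the solution t |-> Pi g (Pi (exp(t X0)) ustar)
    becomes t |-> Pi (exp(- t X0) g exp(t X0)) ustar. This is its derivative,
    obtained from the product rule, strong continuity and the uniform bound on Pi. *)
Lemma conj_orbit_derivative g : G g -> dPi_dom Pi X0 (Pi g ustar) ->
  h^-1 *: (Pi (E (- h)) (Pi g (Pi (E h) ustar)) - Pi g ustar) @[h --> 0^']
    --> Pi g (dPi Pi X0 ustar) - dPi Pi X0 (Pi g ustar).
Proof.
move=> Gg domg.
have lim1 : Pi (E (- h)) (Pi g (dPi_quot Pi X0 ustar h)) @[h --> 0^'] -->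
    Pi g (dPi Pi X0 ustar).
  apply: Pi_expm_cvg_joint => //.
  apply: (cvg_comp _ _ (dPi_quot_cvg ustar_X0)).
  exact: (symm_continuous Pi_symm Gg).
have lim2 : dPi_quot Pi X0 (Pi g ustar) (- h) @[h --> 0^'] --> dPi Pi X0 (Pi g ustar).
  apply/cvg_dnbhsP => e e0; have [d d0 Hd] := (cvg_dnbhsP _ _).1 (dPi_quot_cvg domg) e e0.
  exists d; first exact: d0.
  move=> h h0 hd; apply: (Hd (- h)); first by rewrite oppr_eq0.
  by rewrite normrN.
apply: cvg_eqfun (cvgB lim1 lim2) => h /=.
rewrite !fctE /dPi_quot invrN scaleNr opprK.
exact: quotient_comp.
Qed.

(** Along the symmetry orbit the right-hand side of the equation is the continuous
    path Pi (exp(s X0)) (A ustar + F ustar), so its averages over [0, t] tend to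
    A ustar + F ustar, and by the integral equation to dPi X0 ustar. *)
Lemma relative_equilibrium_eq :
  strong_solution DA A F (symmetry_orbit Pi X0 ustar) -> DA ustar ->
  dPi Pi X0 ustar = A ustar + F ustar.
Proof.
move=> [_ _ sol] Du; set psi := _ + _.
have orbE s : A (symmetry_orbit Pi X0 ustar s) + F (symmetry_orbit Pi X0 ustar s) =
    Pi (E s) psi.
  by rewrite /symmetry_orbit A_Pi// F_Pi// linearD.
apply/eqP; rewrite -subr_eq0 -normr_le0; apply/ler_addgt0Pr => e e0; rewrite add0r.
have e2 : 0 < e / 2 by rewrite divr_gt0.
have [d1 d10 H1] := (cvg_dnbhsP _ _).1 (dPi_quot_cvg ustar_X0) _ e2.
have [d2 /= d20 H2] := (nbhs_ballP _ _).1
  ((cvgrPdist_le _ _).1 (Pi_expm_cvg0 (Y := X0) (phi := psi) X0_g) _ e2).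
pose t := Num.min d1 d2 / 2.
have d0 : 0 < Num.min d1 d2 by rewrite lt_min d10.
have t0 : 0 < t by rewrite divr_gt0.
have tm : t < Num.min d1 d2 by rewrite ltr_pdivrMr// ltr_pMr// ltr1n.
have td1 : t < d1 by apply: lt_le_trans tm _; rewrite ge_min lexx.
have td2 : t < d2 by apply: lt_le_trans tm _; rewrite ge_min lexx orbT.
pose s : seq (set (measurableTypeR R) * X) := [:: (`[0, t]%classic, psi)].
have mu0t : lebesgue_measure (`[0, t]%classic : set (measurableTypeR R)) = t%:E.
  by rewrite lebesgue_measure_itv/= lte_fin t0 oppr0 adde0.
have s_on : simple_on (@lebesgue_measure R) `[0, t]%classic s.
  by split; [exact: measurable_itv|by []|have := ltry t; rewrite -mu0t|].
have est : `|(symmetry_orbit Pi X0 ustar t - symmetry_orbit Pi X0 ustar 0) - t *: psi| <= e / 2 * t.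
  have -> : t *: psi = simple_int (@lebesgue_measure R) s.
    rewrite /simple_int big_seq1/=; congr (_ *: _).
    exact: (esym (congr1 fine mu0t)).
  apply: bochner_itv_near_simple (ltW t0) (sol t (ltW t0)) s_on (ltW e2) _ => x xt.
  rewrite orbE /simple_val big_seq1/= indicE mem_set ?scale1r/= ?in_itv/= ?xt//.
  case/andP: xt => x0 xt.
  by rewrite distrC; apply: H2; rewrite /ball/= sub0r normrN ger0_norm// (le_lt_trans xt).
have -> : dPi Pi X0 ustar - psi = (dPi Pi X0 ustar - dPi_quot Pi X0 ustar t) +
    (dPi_quot Pi X0 ustar t - psi) by rewrite addrA subrK.
rewrite [e]splitr; apply: (le_trans (ler_normD _ _)); apply: lerD.
  by apply: H1; rewrite ?gt_eqF// gtr0_norm.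
rewrite -(ler_pM2r t0); apply: le_trans est.
rewrite -{2}(gtr0_norm t0) mulrC -normrZ scalerBr /dPi_quot scalerA divff ?gt_eqF// scale1r.
by rewrite /symmetry_orbit rscale0 expm0 (symm1 Pi_symm).
Qed.

End Symmetry.

(** exp(e^(tL) Y) is the conjugate of exp Y by exp(tX), so the group element of the
    theorem moves the initial state by exp Y after having followed the
    orbit. *)
Lemma expm_conj_flow (R : realType) (n : nat) (X Y : 'M[R[i]]_n) (t : R) :
  expm (rscale t X) *m expm (exp_op (fun Z => rscale t (bracket Z X)) Y) =
  expm Y *m expm (rscale t X).
Proof.
have EE := expm_rscaleN_mul X t.
have [_ Eu] := mulmx1_unit EE.
have EV : invmx (expm (rscale t X)) = expm (rscale (- t) X).
  by rewrite -[RHS]mulmx1 -(mulmxV Eu) mulmxA EE mul1mx.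
have conj (g : 'M[R[i]]_n) : g \in unitmx ->
    g *m expm (invmx g *m Y *m g) = expm Y *m g.
  by move=> gu; rewrite expm_conj// !mulmxA mulmxV// mul1mx.
rewrite exp_op_bracket.
rewrite -EV.
exact: conj.
Qed.

(** * Deviations from the symmetry orbit *)

Lemma linear3B (R : realType) (X : normedModType R) (f g h : {linear X -> X}) (x y : X) :
  f (g (h (x - y))) = f (g (h x)) - f (g (h y)).
Proof. by rewrite !linearB. Qed.

Lemma linear3D (R : realType) (X : normedModType R) (f g h : {linear X -> X}) (x y : X) :
  f (g (h (x + y))) = f (g (h x)) + f (g (h y)).
Proof. by rewrite !linearD. Qed.

Lemma linearB2 (R : realType) (X : normedModType R) (f : {linear X -> X}) (x y z : X) :
  f (x - y - z) = f x - f y - f z.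
Proof. by rewrite !linearB. Qed.

Lemma defect_identity (V : zmodType) (a f p d a' f' d' : V) :
  a + f - p - (a - p + d - (a' - (a' + f') + d')) = f - f' - (d - d').
Proof.
have -> : a' - (a' + f') = - f' by rewrite opprD addrA subrr add0r.
rewrite -[a - p + d - _]addrA [a + f - p]addrAC [a - p + f]addrC addrKA.
by rewrite [- f' + d']addrC [- (d' - f')]opprB [d + (f' - d')]addrCA opprD addrA.
Qed.

Lemma linear_opp_cancel (R : realType) (X : normedModType R) (f g : {linear X -> X}) (x : X) :
  f (g (- x) + x) = - f (g x) + f x.
Proof. by rewrite !linearN linearD linearN. Qed.

Lemma sub_regroup (V : zmodType) (x y a e : V) : x - y - e = x - (a + e) - (- a + y).
Proof. by rewrite opprD opprK [a + e]addrC opprD !addrA subrK addrAC. Qed.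

Section OrbitDefect.
Context (R : realType) (X : normedModType R) (n : nat).
Local Notation M := 'M[R[i]]_n.
Context (DA : set X) (A F : X -> X) (G : set M) (Pi : M -> {linear X -> X}).
Hypotheses (G_Lie : matrix_Lie_group G) (Pi_symm : symmetry_group G Pi DA A F).
Context (X0 : M) (ustar : X) (S : R -> {linear X -> X}) (K C : R).
Hypothesis Pi_le : forall g phi, G g -> `|Pi g phi| <= K * `|phi|.
Hypothesis K_ge1 : 1 <= K.
Hypothesis C_ge0 : 0 <= C.
Hypothesis X0_g : Lie_algebra G X0.
Hypothesis Du : DA ustar.
Hypothesis ustar_dPi : forall Y, Lie_algebra G Y -> dPi_dom Pi Y ustar.
Hypothesis sol : strong_solution DA A F (symmetry_orbit Pi X0 ustar).
Hypothesis F_diff : differentiable F ustar.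
Hypothesis S_C0 : bounded_C0_semigroup S.
Hypothesis S_le : forall (t : R) phi, 0 <= t -> `|S t phi| <= K * `|phi|.
Hypothesis S_gen : generates (DA `&` dPi_dom Pi X0)
     (fun phi => A phi - dPi Pi X0 phi + 'd F ustar phi) S.
Hypothesis F_taylor : forall v, `|v - ustar| <= 1 ->
  `|F v - F ustar - 'd F ustar (v - ustar)| <= C * `|v - ustar| ^+ 2.
Local Notation E t := (expm (rscale t X0)).
Local Notation uhat := (symmetry_orbit Pi X0 ustar).

Let K_ge0 : 0 <= K. Proof. exact: le_trans K_ge1. Qed.

Let GE t : G (E t). Proof. exact: X0_g. Qed.

Let relE : dPi Pi X0 ustar = A ustar + F ustar.
Proof. exact: (relative_equilibrium_eq G_Lie Pi_symm X0_g (ustar_dPi X0_g)). Qed.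

Lemma norm_evolution_le t t' phi : 0 <= t' <= t ->
  `|evolution Pi X0 S t t' phi| <= K ^+ 3 * `|phi|.
Proof.
move=> /andP[t0 t't]; have -> : K ^+ 3 * `|phi| = K * (K * (K * `|phi|)) by ring.
apply: (le_trans (Pi_le _ (GE t))); apply: ler_wpM2l => //.
apply: (le_trans (S_le _ _)); first by rewrite subr_ge0.
apply: ler_wpM2l => //; exact: (Pi_le _ (GE _)).
Qed.

Lemma evolutionB t t' phi psi :
  evolution Pi X0 S t t' (phi - psi) = evolution Pi X0 S t t' phi - evolution Pi X0 S t t' psi.
Proof. exact: linear3B. Qed.

Lemma evolutionD t t' phi psi :
  evolution Pi X0 S t t' (phi + psi) = evolution Pi X0 S t t' phi + evolution Pi X0 S t t' psi.
Proof. exact: linear3D. Qed.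

Lemma evolution_t0 t phi : evolution Pi X0 S t 0 phi = Pi (E t) (S t phi).
Proof. by rewrite /evolution oppr0 rscale0 expm0 (symm1 Pi_symm) addr0. Qed.

Lemma moving_norm_le (t r : R) v : `|v - uhat t| <= r -> `|Pi (E (- t)) v - ustar| <= K * r.
Proof.
move=> vr; rewrite -[X in _ - X](Pi_expmK Pi_symm t _ X0_g).
rewrite -linearB.
by apply: (le_trans (Pi_le _ (GE _))); exact: ler_wpM2l.
Qed.

Lemma taylor_le (r : R) v : `|v - ustar| <= r -> r <= 1 ->
  `|F v - F ustar - 'd F ustar (v - ustar)| <= C * r ^+ 2.
Proof.
move=> vr r1; apply: (le_trans (F_taylor (le_trans vr r1))).
by rewrite ler_wpM2l// lerXn2r// nnegrE// (le_trans _ vr).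
Qed.

Let symmM3 g1 g2 g3 phi : G g1 -> G g2 -> G g3 ->
  Pi (g1 *m g2 *m g3) phi = Pi g1 (Pi g2 (Pi g3 phi)).
Proof.
move=> G1 G2 G3; have G12 := mxgroupM G_Lie G1 G2.
by rewrite (symmM Pi_symm _ G12 G3) (symmM Pi_symm _ G1 G2).
Qed.

(** The exact solution Pi g (uhat t) follows the linearized evolution of its initial
    deviation up to a quadratic error. In the moving frame it is the path
    z t = Pi (gs t) ustar; subtracting ustar, the derivative of z and the generator
    of S differ by the Taylor remainder of F at ustar, so that
    near_orbit_of_defect applies. *)
Lemma group_orbit_defect g t r : G g -> 0 <= t -> K * r <= 1 ->
  (forall s, 0 <= s <= t -> `|Pi g (uhat s) - uhat s| <= r) ->
  `|Pi g (uhat t) - uhat t - evolution Pi X0 S t 0 (Pi g ustar - ustar)|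
    <= K ^+ 2 * (C * (K * r) ^+ 2) * t.
Proof.
move=> Gg t0 Kr wr.
pose gs s := E (- s) *m g *m E s.
have Ggs s : G (gs s) by apply: (mxgroupM G_Lie) => //; exact: (mxgroupM G_Lie).
pose z s := Pi (gs s) ustar.
have zE s : z s = Pi (E (- s)) (Pi g (uhat s)).
  exact: symmM3.
have gsD c h : gs (c + h) = E (- h) *m gs c *m E h.
  rewrite /gs (_ : - (c + h) = - h + - c); last by rewrite opprD addrC.
  by rewrite (expm_rscaleD (- h) (- c)) (expm_rscaleD c h) !mulmxA.
have zD c h : z (c + h) = Pi (E (- h)) (Pi (gs c) (Pi (E h) ustar)).
  by rewrite /z gsD; exact: symmM3.
have zu s : 0 <= s <= t -> `|z s - ustar| <= K * r.
  by move=> st; rewrite zE; apply: moving_norm_le; exact: wr.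
have domz s : dPi_dom Pi X0 (z s).
  apply: (dPi_dom_Pi G_Lie Pi_symm (Ggs s) X0_g); apply: ustar_dPi.
  exact: (Lie_algebra_conj G_Lie).
have DAz s : DA (z s) by exact: (symm_dom Pi_symm).
pose Ls phi := A phi - dPi Pi X0 phi + 'd F ustar phi.
have defect : `|(z t - ustar) - S t (z 0 - ustar)| <= K * (C * (K * r) ^+ 2) * t.
  apply: (near_orbit_of_defect S_C0 S_le K_ge0 (y := fun s => z s - ustar)
     (y' := fun s => Pi (gs s) (dPi Pi X0 ustar) - dPi Pi X0 (z s))
     (l := fun s => Ls (z s) - Ls ustar) t0).
  - move=> c _.
    apply: cvg_eqfun (conj_orbit_derivative G_Lie Pi_symm Pi_le K_ge0 X0_g
      (ustar_dPi X0_g) (Ggs c) (domz c)).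
    move=> h; congr (_ *: _).
    rewrite opprB addrA subrK.
    congr (_ - _).
    exact: (esym (zD c h)).
  - move=> c _.
    have [_ gen] := S_gen.
    apply: cvg_eqfun (cvgB (gen _ (conj (DAz c) (domz c))) (gen _ (conj Du (ustar_dPi X0_g)))).
    move=> h; rewrite !fctE/=.
    rewrite -scalerBr; congr (_ *: _); rewrite [S h (_ - _)]linearB/=.
    by rewrite !opprB addrACA [RHS]addrACA [- z c - _]addrC.
  - move=> c ct.
    have -> : Pi (gs c) (dPi Pi X0 ustar) - dPi Pi X0 (z c) - (Ls (z c) - Ls ustar) =
       F (z c) - F ustar - 'd F ustar (z c - ustar).
      have -> : Pi (gs c) (dPi Pi X0 ustar) = A (z c) + F (z c).
        rewrite relE /z (A_Pi G_Lie Pi_symm (Ggs c) Du) (F_Pi G_Lie Pi_symm _ (Ggs c)).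
        exact: linearD.
      rewrite /Ls relE (linearB ('d F ustar)).
      exact: defect_identity.
    by apply: taylor_le => //; exact: zu.
rewrite evolution_t0.
have -> : Pi g (uhat t) - uhat t - Pi (E t) (S t (Pi g ustar - ustar)) =
   Pi (E t) ((z t - ustar) - S t (z 0 - ustar)).
  have -> : z 0 = Pi g ustar.
    by rewrite /z /gs oppr0 rscale0 expm0 mul1mx mulmx1.
  rewrite (linearB2 (Pi (E t)) (z t) ustar) zE.
  by rewrite (Pi_expmNK Pi_symm _ _ X0_g).
have -> : K ^+ 2 * (C * (K * r) ^+ 2) * t = K * (K * (C * (K * r) ^+ 2) * t) by ring.
by apply: (le_trans (Pi_le _ (GE t))); exact: ler_wpM2l.
Qed.

(** The same estimate for a mild solution u. The mild equation of uhat itself,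
    uhat t - S(t,0) ustar = integral of S(t,x) (F (uhat x) - F'(uhat x) (uhat x)),
    appears only through simple functions whose integral is exactly the left-hand
    side; they approximate the integrand because S(t,x) of it is
    Pi (exp(t X0)) (S (t - x) w) with w minus the generator at ustar. The integrand
    of u differs from it by a Taylor remainder of F. *)
Lemma mild_solution_defect (T : R) (u : R -> X) v0 t r :
  mild_solution Pi X0 S F ustar (ustar + v0) T u -> 0 <= t <= T -> 0 <= r -> K * r <= 1 ->
  (forall s, 0 <= s <= t -> `|u s - uhat s| <= r) ->
  `|u t - uhat t - evolution Pi X0 S t 0 v0| <= K ^+ 2 * (C * (K * r) ^+ 2) * t.
Proof.
move=> mild tT r0 Kr ur.
have t0 : 0 <= t by case/andP: tT.
apply/ler_addgt0Pr => e e0.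
pose e1 := e / (K * (T + 1)).
have T0 : 0 < T + 1 by rewrite ltr_wpDl//; apply: le_trans t0 _; case/andP: tT.
have K0 : 0 < K by exact: lt_le_trans K_ge1.
have e10 : 0 < e1 by rewrite divr_gt0// mulr_gt0.
pose w := F ustar - 'd F ustar ustar.
have gen : h^-1 *: (S h (- ustar) - (- ustar)) @[h --> 0^'+] --> w.
  have -> : w = - (A ustar - dPi Pi X0 ustar + 'd F ustar ustar).
    by rewrite relE opprD opprB [A ustar + _ - _]addrAC subrr add0r.
  apply: cvg_eqfun (cvgN (S_gen.2 _ (conj Du (ustar_dPi X0_g)))) => h; rewrite !fctE/=.
  by rewrite -scalerN opprB [S h (- _)]linearN opprK addrC.
have [s [s_on s_int s_near]] := orbit_integral_approx S_C0 S_le K_ge0 t0 e10 gen.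
pose s' := [seq (p.1, Pi (E t) p.2) | p <- s].
have s'_on : simple_on (@lebesgue_measure R) `[0, t]%classic s'.
  by rewrite /s'; elim: (s) s_on => //= p l IH [? ? ? /IH].
have s'_int : simple_int (@lebesgue_measure R) s' = Pi (E t) (S t (- ustar) - (- ustar)).
  rewrite -s_int /simple_int big_map linear_sum; apply: eq_bigr => p _.
  by rewrite linearZ.
have s'_val x : simple_val s' x = Pi (E t) (simple_val s x).
  rewrite /simple_val big_map linear_sum; apply: eq_bigr => p _.
  by rewrite linearZ.
have c0 : 0 <= K ^+ 2 * (C * (K * r) ^+ 2) + K * e1.
  apply: addr_ge0; last by apply: mulr_ge0 => //; exact: ltW.
  apply: mulr_ge0; first exact: exprn_ge0.
  by apply: mulr_ge0 => //; apply: exprn_ge0; exact: mulr_ge0.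
have -> : u t - uhat t - evolution Pi X0 S t 0 v0 =
    u t - evolution Pi X0 S t 0 (ustar + v0) - simple_int (@lebesgue_measure R) s'.
  rewrite s'_int evolutionD (evolution_t0 t ustar) opprK (linear_opp_cancel (Pi (E t)) (S t)).
  exact: sub_regroup.
apply: (@le_trans _ _ ((K ^+ 2 * (C * (K * r) ^+ 2) + K * e1) * t)).
  apply: bochner_itv_near_simple t0 (mild t tT) s'_on c0 _ => x xt; rewrite s'_val.
  have /andP[x0 xt'] := xt.
  rewrite /evolution (diff_F_Pi G_Lie Pi_symm _ (GE x) F_diff).
  pose v := Pi (E (- x)) (u x).
  have vu : `|v - ustar| <= K * r by apply: moving_norm_le; exact: ur.
  rewrite -linearB; apply: (le_trans (Pi_le _ (GE t))).
  have -> : K ^+ 2 * (C * (K * r) ^+ 2) + K * e1 = K * (K * (C * (K * r) ^+ 2) + e1) by ring.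
  apply: ler_wpM2l => //.
  have -> : Pi (E (- x)) (F (u x) - Pi (E x) ('d F ustar (Pi (invmx (E x)) (u x)))) =
      w + (F v - F ustar - 'd F ustar (v - ustar)).
    have uxE : u x = Pi (E x) v by rewrite /v (Pi_expmNK Pi_symm).
    rewrite uxE (F_Pi G_Lie Pi_symm _ (GE x)) (Pi_invK G_Lie Pi_symm _ (GE x)).
    rewrite -(linearB (Pi (E x))) (Pi_expmK Pi_symm _ _ X0_g).
    rewrite (linearB ('d F ustar)) opprB addrCA.
    by rewrite (subrKA ('d F ustar ustar)) (subrKA (F ustar)).
  rewrite linearD/= addrAC; apply: (le_trans (ler_normD _ _)).
  rewrite [leLHS]addrC; apply: lerD.
    apply: (le_trans (S_le _ _)); first by rewrite subr_ge0.
    by apply: ler_wpM2l => //; exact: taylor_le.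
  exact: s_near.
rewrite mulrDl lerD2l.
have -> : K * e1 * t = e * (t / (T + 1)).
  by rewrite /e1; field; rewrite !gt_eqF.
rewrite ler_piMr ?(ltW e0)// ler_pdivrMr// mul1r.
by apply: (@le_trans _ _ T); [case/andP: tT|rewrite lerDl].
Qed.

End OrbitDefect.

(** * A priori bounds and conclusion *)

Lemma linear4Z (R : realType) (X : normedModType R) (f g h p : {linear X -> X})
  (c : R) (x : X) : f (g (h (p (c *: x)))) = c *: f (g (h (p x))).
Proof. by rewrite !linearZ. Qed.

Lemma sub_telescope (V : zmodType) (u w h x y : V) :
  u - w = (u - h - x) - (w - h - y) + (x - y).
Proof.
by rewrite [- (w - h - y)]opprB addrAC (subrKA x) (subrKA y) opprB (subrKA h).
Qed.

Lemma continuity_bootstrap (R : realType) (T r : R) (m : R -> R) :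
  {within `[0, T], continuous m} -> m 0 < r ->
  (forall t, 0 <= t <= T -> (forall s, 0 <= s <= t -> m s <= r) -> m t < r) ->
  forall t, 0 <= t <= T -> m t < r.
Proof.
move=> /subspace_continuousP cm m0 step; apply: real_induction => c cT mc.
have cI : `[0, T]%classic c by rewrite /= in_itv.
have cvc := cm c cI.
have near_c (e : R) : 0 < e -> exists2 d, 0 < d &
    forall s, 0 <= s <= T -> `|c - s| < d -> `|m c - m s| <= e.
  move=> e0; have [d /= d0 Hd] := (nbhs_ballP _ _).1 ((cvgrPdist_le _ _).1 cvc e e0).
  by exists d => // s sT cs; apply: Hd => //; rewrite /= in_itv.
have mcr : m c <= r.
  apply/ler_addgt0Pr => e e0; have [d d0 Hd] := near_c e e0.
  have [c0|cn0] := eqVneq c 0; first by rewrite c0 (le_trans (ltW m0))// lerDl ltW.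
  have c0 : 0 < c by rewrite lt_neqAle eq_sym cn0; case/andP: cT.
  pose h := Num.min (d / 2) c.
  have h0 : 0 < h by rewrite lt_min c0 divr_gt0.
  have hd : h < d by rewrite /h gt_min ltr_pdivrMr// ltr_pMr// ltr1n.
  have hc : h <= c by rewrite ge_min lexx orbT.
  have s0 : 0 <= c - h < c by rewrite subr_ge0 hc/= gtrBl.
  have sT : 0 <= c - h <= T.
    case/andP: s0 => -> sc; rewrite (le_trans (ltW sc))//; by case/andP: cT.
  have := Hd (c - h) sT; rewrite subKr gtr0_norm// => /(_ hd).
  have := mc (c - h) s0; have := ler_norm (m c - m (c - h)); lra.
have mltr : m c < r.
  apply: step => // s /andP[s0 sc]; have [->//|sn] := eqVneq s c.
  by apply: ltW; apply: mc; rewrite s0 lt_neqAle sn.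
have e0 : 0 < (r - m c) / 2 by rewrite divr_gt0// subr_gt0.
have [d d0 Hd] := near_c _ e0; exists d => // s /andP[cs sT] sd.
have sT' : 0 <= s <= T by rewrite sT andbT (le_trans _ cs)//; case/andP: cT.
have cs_d : `|c - s| < d by rewrite ler0_norm ?subr_le0// opprB ltrBlDl.
have := Hd s sT' cs_d; rewrite distrC; have := ler_norm (m s - m c); lra.
Qed.

Lemma le_of_right_squares (R : realType) (b rho x c : R) : 0 <= c -> 0 <= b -> b < rho ->
  (forall y, b < y <= rho -> x <= c * y ^+ 2) -> x <= c * b ^+ 2.
Proof.
move=> c0 b0 brho H; apply/ler_addgt0Pr => e e0.
pose B := c * (2 * b + 1) + 1.
have B0 : 0 < B by rewrite ltr_wpDl// mulr_ge0// addr_ge0// mulr_ge0.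
pose eta := Num.min (rho - b) (Num.min 1 (e / B)).
have eta0 : 0 < eta by rewrite !lt_min subr_gt0 brho ltr01 divr_gt0.
have eta1 : eta <= 1 by rewrite !ge_min lexx orbT.
have etae : eta * B <= e by rewrite -ler_pdivlMr// !ge_min lexx !orbT.
have etar : eta <= rho - b by rewrite ge_min lexx.
apply: (le_trans (H (b + eta) _)); first by rewrite ltrDl eta0 -lerBrDl.
have : c * eta ^+ 2 <= c * eta by rewrite ler_wpM2l// expr2 ler_piMl// ltW.
by move: etae; rewrite /B; nra.
Qed.

(** The distance m to the reference orbit is at most the linear evolution k b of the
    initial deviation b, plus err, which is quadratic in the size of m so far. For
    small b, m never reaches 2 k y for y slightly above b. Such a y is used in place
    of b because the bound has to be strict, including for b = 0. *)
Lemma quadratic_bootstrap (R : realType) (T k B rho0 b : R) (m err : R -> R) :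
  1 <= k -> 0 <= B -> 0 <= b -> b < rho0 -> 4 * k * B * rho0 <= 1 ->
  {within `[0, T], continuous m} -> m 0 <= b ->
  (forall t, 0 <= t <= T -> m t <= k * b + err t) ->
  (forall t r, 0 <= t <= T -> 0 <= r <= 2 * k * rho0 ->
     (forall s, 0 <= s <= t -> m s <= r) -> err t <= B * r ^+ 2) ->
  forall t, 0 <= t <= T -> err t <= 4 * k ^+ 2 * B * b ^+ 2.
Proof.
move=> k1 B0 b0 brho small cm m0 m_err err_le t tT.
have k0 : 0 <= k by exact: le_trans k1.
apply: (@le_of_right_squares _ b rho0) => //; first by rewrite !mulr_ge0// exprn_ge0.
move=> y /andP[by_ yrho].
have y0 : 0 < y by exact: le_lt_trans by_.
have r0 : 0 <= 2 * k * y <= 2 * k * rho0.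
  by rewrite !mulr_ge0 ?(ltW y0)//= ler_wpM2l// mulr_ge0.
have mlt s : 0 <= s <= T -> m s < 2 * k * y.
  apply: continuity_bootstrap => // [|{}s sT ms].
    by apply: (le_lt_trans m0); nra.
  apply: (le_lt_trans (m_err s sT)); have := err_le s _ sT r0 ms.
  have : B * (2 * k * y) ^+ 2 <= k * y.
    have -> : B * (2 * k * y) ^+ 2 = (4 * k * B * y) * (k * y) by ring.
    rewrite ler_piMl ?mulr_ge0 ?(ltW y0)//; apply: le_trans small.
    by rewrite ler_wpM2l// !mulr_ge0.
  have : k * b < k * y by rewrite ltr_pM2l// (lt_le_trans ltr01).
  lra.
have -> : 4 * k ^+ 2 * B * y ^+ 2 = B * (2 * k * y) ^+ 2 by ring.
apply: err_le => // s /andP[s0 st]; apply: ltW; apply: mlt.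
by rewrite s0 (le_trans st)//; case/andP: tT.
Qed.

Theorem theorem4p5 (R : realType) (X : completeNormedModType R)
  (DA : set X) (A : X -> X) (F : X -> X)
  (n : nat) (G : set 'M[R[i]]_n) (Pi : 'M[R[i]]_n -> {linear X -> X})
  (Ng : 'M[R[i]]_n -> R)
  (X0 : 'M[R[i]]_n) (ustar : X)
  (Sstar : R -> {linear X -> X}) (Pc Ps : {linear X -> X})
  (calP : X -> 'M[R[i]]_n)
  (M M3 a : R)
  (A_closed : closed_operator DA A)
  (* symmetry *)
  (G_Lie : matrix_Lie_group G)
  (Ng_norm : is_norm_on (Lie_algebra G) Ng)
  (Pi_symm : symmetry_group G Pi DA A F)
  (* symmetry solution *)
  (X0_g : Lie_algebra G X0)
  (ustar_dom : DA ustar /\ dPi_dom Pi X0 ustar)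
  (uhat_strong : strong_solution DA A F (symmetry_orbit Pi X0 ustar))
  (ustar_dPi : forall Y, Lie_algebra G Y -> dPi_dom Pi Y ustar)
  (ustar_smooth : exists C : R, forall Y, Lie_algebra G Y ->
     `|Pi (expm Y) ustar - ustar - dPi Pi Y ustar| <= C * Ng Y ^+ 2)
  (* linearization *)
  (F_diff : differentiable F ustar)
  (Sstar_C0 : bounded_C0_semigroup Sstar)
  (Lstar_gen : generates (DA `&` dPi_dom Pi X0)
     (fun phi => A phi - dPi Pi X0 phi + 'd F ustar phi) Sstar)
  (* decomposition *)
  (Pc_proj : is_projection Pc) (Ps_proj : is_projection Ps)
  (PcPs : forall phi, phi = Pc phi + Ps phi)
  (Pc_range : range Pc = center_space G Pi ustar)
  (M_gt0 : 0 < M) (a_gt0 : 0 < a)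
  (Sstar_decay : forall t, 0 <= t ->
     (opnorm (Sstar t \o Ps) <= (M * expR (- a * t))%:E)%E)
  (* regularity of F *)
  (F_reg : forall r : R, 0 < r -> exists C : R, forall v : X,
     `|v - ustar| <= r ->
     `|F v - F ustar - 'd F ustar (v - ustar)| <= C * `|v - ustar| ^+ 2)
  (* the map calP into the Lie algebra *)
  (calP_g : forall phi, Lie_algebra G (calP phi))
  (calP_linear : forall (c : R) phi psi,
     calP (c *: phi + psi) = rscale c (calP phi) + calP psi)
  (calP_bounded : exists C : R, forall phi, Ng (calP phi) <= C * `|phi|)
  (calP_Pc : forall phi, Pc phi = dPi Pi (calP phi) ustar)
  (* the constant M3 *)
  (M3_gt0 : 0 < M3)
  (S_decay : forall t t', 0 <= t' -> t' <= t ->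
     (opnorm (evolution Pi X0 Sstar t t' \o moving_proj Pi X0 Ps t')
        <= (M3 * expR (- a * (t - t')))%:E)%E) :
  let L := fun Y => bracket Y X0 in
  forall T delta : R, 0 < T -> 0 < delta ->
  exists2 eps : R, 0 < eps &
  forall v0 : X, `|v0| <= eps ->
  forall u : R -> X,
    {within `[0, T], continuous u} ->
    mild_solution Pi X0 Sstar F ustar (ustar + v0) T u ->
  forall t, 0 <= t <= T ->
    let gamma := expm (rscale t X0)
                 *m expm (exp_op (fun Y => rscale t (L Y)) (calP v0)) in
    `|u t - Pi gamma ustar| <= (M3 * expR (- a * t) + delta) * `|v0|.

Proof.
move=> L T delta T_gt0 delta_gt0.
have [Kp Kp_le] := symm_bounded Pi_symm.
have [Ks Ks_le] := semigroup_bounded Sstar_C0.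
pose K := Num.max 1 (Num.max Kp Ks).
have K_ge1 : 1 <= K by rewrite le_max lexx.
have K_ge0 : 0 <= K by exact: le_trans K_ge1.
have Pi_le g phi : G g -> `|Pi g phi| <= K * `|phi|.
  move=> Gg; have PiZ c psi : Pi g (c *: psi) = c *: Pi g psi by exact: linearZ.
  apply: (le_trans (le_opnorm phi PiZ (Kp_le g Gg))).
  by rewrite ler_wpM2r// !le_max lexx orbT.
have S_le t phi : 0 <= t -> `|Sstar t phi| <= K * `|phi|.
  move=> t0; have SZ c psi : Sstar t (c *: psi) = c *: Sstar t psi by exact: linearZ.
  apply: (le_trans (le_opnorm phi SZ (Ks_le t t0))).
  by rewrite ler_wpM2r// !le_max lexx !orbT.
have [C0 C0_taylor] := F_reg 1 ltr01.
pose C := Num.max C0 0.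
have C_ge0 : 0 <= C by rewrite le_max lexx orbT.
have F_taylor v : `|v - ustar| <= 1 ->
    `|F v - F ustar - 'd F ustar (v - ustar)| <= C * `|v - ustar| ^+ 2.
  move=> v1; apply: (le_trans (C0_taylor v v1)).
  by rewrite ler_wpM2r ?exprn_ge0// le_max lexx.
have [Cg0 Cg0_le] := ustar_smooth; have [Cp0 Cp0_le] := calP_bounded.
pose Cg := Num.max Cg0 0; pose Cp := Num.max Cp0 0.
have Cg_ge0 : 0 <= Cg by rewrite le_max lexx orbT.
have Cp_ge0 : 0 <= Cp by rewrite le_max lexx orbT.
have [Kc Kc_ge0 Pc_le] : exists2 Kc : R, 0 <= Kc & forall phi, `|Pc phi| <= Kc * `|phi|.
  have := (linear_boundedP Pc).1 ((linear_bounded_continuous Pc).2 Pc_proj.1).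
  move=> [c [_ Hc]]; exists (Num.max (c + 1) 0); first by rewrite le_max lexx orbT.
  move=> phi; apply: (le_trans (Hc (c + 1) _ phi)); first by rewrite ltrDl.
  by rewrite ler_wpM2r// le_max lexx.
(* initial deviation of the exact solution with which u is compared *)
pose w0 v0 := Pi (expm (calP v0)) ustar - ustar.
pose q := Cg * Cp ^+ 2.
have q_ge0 : 0 <= q by rewrite mulr_ge0// exprn_ge0.
have w0_Pc v0 : `|w0 v0 - Pc v0| <= q * `|v0| ^+ 2.
  rewrite calP_Pc; apply: (le_trans (Cg0_le _ (calP_g v0))).
  have N0 := norm_on_ge0 Ng_norm (calP_g v0).
  have N1 : Ng (calP v0) <= Cp * `|v0|.
    by apply: (le_trans (Cp0_le v0)); rewrite ler_wpM2r// le_max lexx.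
  apply: (@le_trans _ _ (Cg * Ng (calP v0) ^+ 2)).
    by rewrite ler_wpM2r ?exprn_ge0// le_max lexx.
  rewrite /q -mulrA -exprMn ler_wpM2l// lerXn2r// nnegrE//.
  by rewrite mulr_ge0.
pose k := K ^+ 3; pose B := K ^+ 2 * (C * K ^+ 2) * T.
have k_ge1 : 1 <= k by rewrite exprn_ege1.
have k_ge0 : 0 <= k by exact: exprn_ge0.
have B_ge0 : 0 <= B by rewrite !mulr_ge0 ?exprn_ge0// ltW.
have K_gt0 : 0 < K by exact: lt_le_trans K_ge1.
have k_gt0 : 0 < k by exact: lt_le_trans k_ge1.
have kK_gt0 : 0 < 2 * k * K by apply: mulr_gt0 => //; exact: mulr_gt0.
have kB_ge0 : 0 <= 4 * k * B by apply: mulr_ge0 => //; exact: mulr_ge0.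
have den_gt0 : 0 < 2 * k * K + 4 * k * B by exact: ltr_pwDl.
(* below rho0, deviations of size 2 k rho0 stay, in the moving frame, within the unit
   ball, where C controls the Taylor remainder, and the quadratic error is at most k rho0 *)
pose rho0 := (2 * k * K + 4 * k * B)^-1.
have rho0_gt0 : 0 < rho0 by rewrite invr_gt0.
have rho0_K : 2 * k * K * rho0 <= 1 by rewrite ler_pdivrMr// mul1r lerDl.
have rho0_B : 4 * k * B * rho0 <= 1 by rewrite ler_pdivrMr// mul1r lerDr ltW.
pose uhat := symmetry_orbit Pi X0 ustar.
pose ev t phi := evolution Pi X0 Sstar t 0 phi.
have ev_le t phi : 0 <= t -> `|ev t phi| <= k * `|phi|.
  by move=> t0; apply: (norm_evolution_le Pi_le K_ge1 X0_g S_le); rewrite lexx.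
have uhat0 : uhat 0 = ustar by rewrite /uhat /symmetry_orbit rscale0 expm0 (symm1 Pi_symm).
have uhat_cont : {within `[0, T], continuous uhat}.
  case: uhat_strong => + _ _; apply: continuous_subspaceW => t /=.
  by rewrite !in_itv/= andbT => /andP[].
pose D := 4 * k ^+ 2 * B.
have D_ge0 : 0 <= D.
  by apply: mulr_ge0 => //; apply: mulr_ge0 => //; exact: exprn_ge0.
have path_err (p : R -> X) (v : X) :
    {within `[0, T], continuous p} -> p 0 = ustar + v -> `|v| < rho0 ->
    (forall t r, 0 <= t <= T -> 0 <= r -> K * r <= 1 ->
       (forall s, 0 <= s <= t -> `|p s - uhat s| <= r) ->
       `|p t - uhat t - ev t v| <= K ^+ 2 * (C * (K * r) ^+ 2) * t) ->
    forall t, 0 <= t <= T -> `|p t - uhat t - ev t v| <= D * `|v| ^+ 2.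
  move=> p_cont p0 v_small defect.
  apply: (quadratic_bootstrap (rho0 := rho0) (m := fun s => `|p s - uhat s|)) => //.
  - apply/subspace_continuousP => t tT; apply: cvg_norm; apply: cvgB.
      by move: tT; exact: (subspace_continuousP _ _).1 p_cont t.
    by move: tT; exact: (subspace_continuousP _ _).1 uhat_cont t.
  - by rewrite p0 uhat0 addrC addKr.
  - move=> t /andP[t0 _].
    rewrite -[X in `|X| <= _](subrKC (ev t v)).
    by apply: (le_trans (ler_normD _ _)); rewrite lerD2r; exact: ev_le.
  - move=> t r tT /andP[r0 r_le] pr.
    have Kr : K * r <= 1.
      apply: le_trans rho0_K; have -> : 2 * k * K * rho0 = K * (2 * k * rho0) by ring.
      exact: ler_wpM2l.
    apply: (le_trans (defect t r tT r0 Kr pr)).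
    have -> : B * r ^+ 2 = K ^+ 2 * (C * (K * r) ^+ 2) * T by rewrite /B; ring.
    rewrite ler_wpM2l ?mulr_ge0 ?exprn_ge0 ?mulr_ge0//.
    by case/andP: tT.
pose kw := Kc + q.
have kw_ge0 : 0 <= kw by rewrite addr_ge0.
have w0_le v0 : `|v0| <= 1 -> `|w0 v0| <= kw * `|v0|.
  move=> v1; rewrite -(subrK (Pc v0) (w0 v0)); apply: (le_trans (ler_normD _ _)).
  rewrite /kw mulrDl addrC; apply: lerD; first exact: Pc_le.
  by apply: (le_trans (w0_Pc v0)); rewrite ler_wpM2l// expr2 ler_piMl.
pose Q := D + D * kw ^+ 2 + k * q.
have Q_ge0 : 0 <= Q.
  apply: addr_ge0; last exact: mulr_ge0.
  by apply: addr_ge0 => //; apply: mulr_ge0 => //; exact: exprn_ge0.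
have kw1 : 0 < 2 * (kw + 1) by apply: mulr_gt0 => //; exact: ltr_wpDl.
have Q1 : 0 < Q + 1 by exact: ltr_wpDl.
exists (Num.min 1 (Num.min (rho0 / 2) (Num.min (rho0 / (2 * (kw + 1))) (delta / (Q + 1))))).
  by rewrite !lt_min ltr01 (divr_gt0 rho0_gt0)// (divr_gt0 rho0_gt0 kw1) divr_gt0.
move=> v0; rewrite !le_min => /and4P[v0_1 v0_rho v0_kw v0_delta] u u_cont u_mild t tT.
cbv zeta; set gamma := (X in Pi X ustar).
have t_ge0 : 0 <= t by case/andP: tT.
have v0_lt : `|v0| < rho0 by apply: (le_lt_trans v0_rho); rewrite ltr_pdivrMr// ltr_pMr// ltr1n.
have w0_lt : `|w0 v0| < rho0.
  apply: (le_lt_trans (w0_le v0 v0_1)).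
  move: v0_kw; rewrite ler_pdivlMr//.
  move: (normr_ge0 v0) kw_ge0 rho0_gt0; clearbody kw rho0.
  by move: `|v0| => y; clear; nra.
have u0E : u 0 = ustar + v0.
  have T00 : 0 <= (0 : R) <= T by rewrite lexx ltW.
  pose f0 := evolution Pi X0 Sstar 0 0
     (F (u 0) - 'd F (symmetry_orbit Pi X0 ustar 0) (u 0)).
  have := @bochner_itv_near_simple _ _ 0 `|f0| _ _ [::] (lexx _) (u_mild 0 T00) I (normr_ge0 _).
  rewrite mulr0 /simple_int big_nil subr0 => est.
  apply/eqP; rewrite -subr_eq0 -normr_le0.
  have evE : evolution Pi X0 Sstar 0 0 (ustar + v0) = ustar + v0.
    by rewrite (evolution_t0 Pi_symm) rscale0 expm0 (symm1 Pi_symm) (semigroup0 Sstar_C0).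
  rewrite evE in est; apply: est => x x0.
  have -> : x = 0 by apply: le_anti; rewrite andbC.
  by rewrite /simple_val big_nil subr0.
have [u_DA _] := ustar_dom.
have GY : G (expm (calP v0)) by exact: (mxgroup_expm1 (calP_g v0)).
pose w s := Pi (expm (calP v0)) (uhat s).
have wE : Pi gamma ustar = w t.
  have -> : gamma = expm (calP v0) *m expm (rscale t X0) by exact: expm_conj_flow.
  exact: (symmM Pi_symm _ GY (X0_g t)).
have u_err : `|u t - uhat t - ev t v0| <= D * `|v0| ^+ 2.
  apply: path_err => // s r sT r0 Kr ur.
  exact: (mild_solution_defect G_Lie Pi_symm Pi_le K_ge1 C_ge0 X0_g u_DA ustar_dPi uhat_strong
    F_diff Sstar_C0 S_le Lstar_gen F_taylor u_mild sT r0 Kr ur).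
have w_cont : {within `[0, T], continuous w}.
  apply/subspace_continuousP => s sT.
  apply: (cvg_comp _ _ ((subspace_continuousP _ _).1 uhat_cont s sT)).
  exact: (symm_continuous Pi_symm GY).
have w0E : w 0 = ustar + w0 v0 by rewrite /w uhat0 /w0 subrKC.
have w_err : `|w t - uhat t - ev t (w0 v0)| <= D * `|w0 v0| ^+ 2.
  apply: (path_err w (w0 v0) w_cont w0E w0_lt _ t tT) => s r /andP[s0 sT] r0 Kr wr.
  exact: (group_orbit_defect G_Lie Pi_symm Pi_le K_ge1 C_ge0 X0_g u_DA ustar_dPi uhat_strong
    Sstar_C0 S_le Lstar_gen F_taylor GY s0 Kr wr).
have w0_err : D * `|w0 v0| ^+ 2 <= D * kw ^+ 2 * `|v0| ^+ 2.
  rewrite -mulrA -exprMn ler_wpM2l// lerXn2r// ?nnegrE ?mulr_ge0//.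
  exact: w0_le.
have s_err : `|ev t (Ps v0)| <= M3 * expR (- a * t) * `|v0|.
  have := S_decay t 0 (lexx _) t_ge0; rewrite subr0 => decay.
  have mp0 phi : moving_proj Pi X0 Ps 0 phi = Ps phi.
    rewrite /moving_proj oppr0 rscale0 expm0 !(symm1 Pi_symm).
    by [].
  have -> : ev t (Ps v0) = (evolution Pi X0 Sstar t 0 \o moving_proj Pi X0 Ps 0) v0.
    by rewrite /ev /= mp0.
  apply: (le_opnorm v0 _ decay) => c psi.
  rewrite /= !mp0.
  exact: linear4Z.
have c_err : `|ev t (Pc v0 - w0 v0)| <= k * q * `|v0| ^+ 2.
  apply: (le_trans (ev_le _ _ t_ge0)); rewrite -mulrA ler_wpM2l//.
  by rewrite distrC; exact: w0_Pc.
rewrite wE.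
have -> : u t - w t = (u t - uhat t - ev t v0) - (w t - uhat t - ev t (w0 v0)) +
   (ev t (Ps v0) + ev t (Pc v0 - w0 v0)).
  have -> : ev t (Ps v0) + ev t (Pc v0 - w0 v0) = ev t v0 - ev t (w0 v0).
    have evB := evolutionB Pi X0 Sstar t 0 v0 (w0 v0).
    have evD := evolutionD Pi X0 Sstar t 0 (Ps v0) (Pc v0 - w0 v0).
    apply: etrans (esym evD) _; apply: etrans _ evB.
    by congr (evolution _ _ _ _ _ _); rewrite addrA [Ps v0 + _]addrC -PcPs.
  exact: sub_telescope.
apply: (le_trans (ler_normD _ _)).
apply: (le_trans (lerD (ler_normB _ _) (ler_normD _ _))).
apply: (le_trans (lerD (lerD u_err (le_trans w_err w0_err)) (lerD s_err c_err))).
have Qd : Q * `|v0| <= delta.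
  move: v0_delta; rewrite ler_pdivlMr// => /(le_trans _); apply.
  by rewrite mulrC ler_wpM2l// lerDl.
have Qv0 : Q * `|v0| ^+ 2 <= delta * `|v0| by rewrite expr2 mulrA ler_wpM2r.
rewrite [leRHS]mulrDl [leLHS]addrCA lerD2l; apply: le_trans Qv0.
by rewrite /Q !mulrDl.
Qed.
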